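(* Let $T$ be a universal theory of graphs. If $\mathcal{M}[T]$ is primally almost finite, then the edge relation in $T$ has NIP. In particular, every universal theory of graphs $T'$ with the weakly random Erdős–Hajnal property and with $\mathcal{M}[T']$ closed under substitutions has NIP.
   Context: A universal theory of graphs $T$ is identified with its class $\mathcal{M}[T]$ of finite models (a family of finite graphs closed under isomorphism and induced subgraphs). The edge relation in $T$ has NIP if $\sup\{\mathrm{VC}(G):G\in\mathcal{M}[T]\}<\infty$, where $\mathrm{VC}(G)$ is the largest size of a set $U\subseteq V(G)$ such that for each $A\subseteq U$ some vertex $v$ has $N_G(v)\cap U=A$. The substitution $F_1^{v\to F_2}$ replaces $v\in V(F_1)$ by a copy of $F_2$ each of whose vertices is adjacent to exactly the neighbours of $v$; $F$ is prime if it is not of the form $F_1^{v\to F_2}$ with $|F_1|,|F_2|<|F|$; a family is primally almost finite if its prime members contain no infinite antichain in the induced-subgraph order. A graphon of $T$ is a graphon that is the limit of a convergent sequence of graphs of $\mathcal{M}[T]$. For a graphon $W$ (symmetric measurable $X\times X\to[0,1]$), a subgraphon is $W$ on $(X,\mu_f)$, $\mu_f(B)=\int_Bf\,d\mu/\int f\,d\mu$ for measurable $f\colon X\to[0,1]$ with $\int f>0$; $W$ is weakly random if the set of finite graphs of positive induced density is the same in $W$ and all its subgraphons. $T$ has the weakly random Erdős–Hajnal property if every graphon of $T$ has a weakly random subgraphon. *)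

(* Defs.v *)
From HB Require Import structures.
From mathcomp Require Import all_boot all_order all_algebra.
From mathcomp Require Import all_classical all_reals all_analysis measurable_realfun.

Set Implicit Arguments.
Unset Strict Implicit.
Unset Printing Implicit Defensive.

Import Order.TTheory GRing.Theory Num.Theory.
Import numFieldNormedType.Exports.

Local Open Scope classical_set_scope.
Local Open Scope ring_scope.

Record sgraph := SGraph {
  vertex :> finType;
  edge : rel vertex;
  edge_sym : symmetric edge;
  edge_irr : irreflexive edge }.

Arguments edge : clear implicits.

Definition iso (F G : sgraph) : Prop :=
  exists2 f : F -> G, bijective f & forall x y, edge G (f x) (f y) = edge F x y.

Section Induced.
Variables (G : sgraph) (U : {set G}).

Definition induced_rel : rel {x : G | x \in U} :=
  fun x y => edge G (val x) (val y).

Lemma induced_sym : symmetric induced_rel.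
Proof. by move=> x y; rewrite /induced_rel edge_sym. Qed.

Lemma induced_irr : irreflexive induced_rel.
Proof. by move=> x; rewrite /induced_rel edge_irr. Qed.

Definition induced : sgraph := SGraph induced_sym induced_irr.

End Induced.

Definition induced_le (F G : sgraph) : Prop :=
  exists U : {set G}, iso F (induced U).

Section Substitution.
Variables (F1 : sgraph) (v : F1) (F2 : sgraph).

Definition subst_rel : rel ({x : F1 | x != v} + F2)%type :=
  fun a b => match a, b with
  | inl x, inl y => edge F1 (val x) (val y)
  | inl x, inr _ => edge F1 (val x) v
  | inr _, inl y => edge F1 v (val y)
  | inr x, inr y => edge F2 x y
  end.

Lemma subst_sym : symmetric subst_rel.
Proof. by move=> [x|x] [y|y] /=; rewrite edge_sym. Qed.

Lemma subst_irr : irreflexive subst_rel.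
Proof. by move=> [x|x] /=; rewrite edge_irr. Qed.

Definition subst : sgraph := SGraph subst_sym subst_irr.

End Substitution.

Definition prime_graph (F : sgraph) : Prop :=
  ~ exists (F1 : sgraph) (v : F1) (F2 : sgraph),
      [/\ (#|F1| < #|F|)%N, (#|F2| < #|F|)%N & iso F (subst v F2)].

(* A universal theory of graphs is represented by its class of finite models:
   the classes of finite graphs closed under isomorphism and induced subgraphs
   are exactly the classes of finite models of such theories. *)
Record universal_theory := UniversalTheory {
  models : sgraph -> Prop;
  models_iso : forall F G, iso F G -> models F -> models G;
  models_induced : forall (G : sgraph) (U : {set G}), models G -> models (induced U) }.

Definition substitution_closed (T : universal_theory) : Prop :=
  forall (F1 : sgraph) (v : F1) (F2 : sgraph),
    models T F1 -> models T F2 -> models T (subst v F2).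

Definition primally_almost_finite (T : universal_theory) : Prop :=
  ~ exists P : nat -> sgraph,
      (forall i, models T (P i) /\ prime_graph (P i)) /\
      (forall i j, i <> j -> ~ induced_le (P i) (P j)).

Definition neighbours (G : sgraph) (v : G) : {set G} := [set w | edge G v w]%SET.

Definition shattered (G : sgraph) (U : {set G}) : bool :=
  [forall (A : {set G} | A \subset U),
    exists v : G, (neighbours v :&: U)%SET == A].

Definition VC (G : sgraph) : nat := (\max_(U : {set G} | shattered U) #|U|)%N.

Definition NIP (T : universal_theory) : Prop :=
  exists k : nat, forall G : sgraph, models T G -> (VC G <= k)%N.

Record graphon (R : realType) := Graphon {
  gdisp : measure_display;
  gspace : measurableType gdisp;
  gprob : probability gspace R;
  gfun :> gspace -> gspace -> R;
  gfun_sym : forall x y, gfun x y = gfun y x;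
  gfun_range : forall x y, 0 <= gfun x y <= 1;
  gfun_meas : measurable_fun [set: gspace * gspace] (fun p => gfun p.1 p.2) }.

Record weight (R : realType) (W : graphon R) := Weight {
  wfun :> gspace W -> R;
  wfun_meas : measurable_fun [set: gspace W] wfun;
  wfun_range : forall x, 0 <= wfun x <= 1;
  wfun_pos : 0 < \int[gprob W]_x wfun x }.

Section Subgraphon.
Variables (R : realType) (W : graphon R) (f : weight W).
Local Notation mu := (gprob W).

Definition wprob (B : set (gspace W)) : \bar R :=
  ((\int[mu]_(x in B) f x) / (\int[mu]_x f x))%:E.

Fact integrable_weight B : measurable B -> mu.-integrable B (EFin \o f).
Proof.
move=> mB; apply: (@integrableS _ _ _ _ setT) => //.
apply: (@le_integrable _ _ _ _ _ measurableT _ (EFin \o cst 1)).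
- by apply/measurable_EFinP; exact: wfun_meas.
- move=> x _ /=; have /andP[f0 f1] := wfun_range f x.
  by rewrite lee_fin !ger0_norm.
- exact: finite_measure_integrable_cst.
Qed.

Fact wprobE B : measurable B -> wprob B =
  (((\int[mu]_x f x)^-1)%:E * \int[mu]_(x in B) (f x)%:E)%E.
Proof.
move=> mB; rewrite /wprob mulrC EFinM /Rintegral fineK//.
exact: integrable_fin_num (integrable_weight mB).
Qed.

Fact wprob0 : wprob set0 = 0%E.
Proof. by rewrite /wprob Rintegral_set0 mul0r. Qed.

Fact wprob_ge0 B : (0 <= wprob B)%E.
Proof.
rewrite lee_fin divr_ge0//; last exact: ltW (wfun_pos f).
by apply: Rintegral_ge0 => x _; have /andP[] := wfun_range f x.
Qed.

Fact wprob_sigma_additive : semi_sigma_additive wprob.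
Proof.
move=> F mF tF mUF; rewrite wprobE//.
under eq_fun do under eq_bigr do rewrite wprobE//.
have f0 x : (0 <= (f x)%:E)%E by have /andP[] := wfun_range f x.
rewrite ge0_integral_bigcup//; last first.
  by apply: measurable_funTS; apply/measurable_EFinP; exact: wfun_meas.
have cge0 : (0 <= ((\int[mu]_x f x)^-1)%:E)%E.
  by rewrite lee_fin invr_ge0 ltW// (wfun_pos f).
rewrite -nneseriesZl//; last by move=> i _; exact: integral_ge0.
apply: is_cvg_nneseries => i _ _; apply: mule_ge0 => //.
exact: integral_ge0.
Qed.

HB.instance Definition _ := isMeasure.Build _ _ _
  wprob wprob0 wprob_ge0 wprob_sigma_additive.

Fact wprob_setT : wprob [set: _] = 1%E.
Proof. by rewrite /wprob divff// gt_eqF// (wfun_pos f). Qed.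

HB.instance Definition _ := @Measure_isProbability.Build _ _ R
  wprob wprob_setT.

Definition subgraphon : graphon R :=
  @Graphon R (gdisp W) (gspace W) wprob (@gfun R W)
    (@gfun_sym R W) (@gfun_range R W) (@gfun_meas R W).

End Subgraphon.

Fixpoint iterated_integral (R : realType) d (X : measurableType d)
    (mu : probability X R) (n : nat) : (n.-tuple X -> \bar R) -> \bar R :=
  match n with
  | 0 => fun g => g [tuple]
  | m.+1 => fun g =>
      (\int[mu]_x iterated_integral mu (fun t : m.-tuple X => g [tuple of x :: t]))%E
  end.

(* The probability that the random graph sampled from W, with vertex set that
   of F, is equal to F. *)
Definition ind_density (R : realType) (F : sgraph) (W : graphon R) : \bar R :=
  iterated_integral (gprob W) (fun x : #|F|.-tuple (gspace W) =>
    (\prod_(i < #|F|) \prod_(j < #|F| | (i < j)%N)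
       if edge F (enum_val i) (enum_val j) then W (tnth x i) (tnth x j)
       else 1 - W (tnth x i) (tnth x j))%:E).

Definition ind_embeddings (F G : sgraph) : {set {ffun F -> G}} :=
  [set h : {ffun F -> G} | injectiveb h &&
    [forall x, forall y, edge G (h x) (h y) == edge F x y]]%SET.

Definition finite_ind_density (R : realType) (F G : sgraph) : R :=
  #|ind_embeddings F G|%:R / (#|G| ^_ #|F|)%:R.

Definition converges_to (R : realType) (G : nat -> sgraph) (W : graphon R) : Prop :=
  #|G n| @[n --> \oo] --> \oo /\
  forall F : sgraph,
    (finite_ind_density R F (G n))%:E @[n --> \oo] --> ind_density F W.

Definition graphon_of (R : realType) (T : universal_theory) (W : graphon R) : Prop :=
  exists2 G : nat -> sgraph, forall n, models T (G n) & converges_to G W.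

Definition positive_in (R : realType) (W : graphon R) (F : sgraph) : Prop :=
  (0 < ind_density F W)%E.

Definition weakly_random (R : realType) (W : graphon R) : Prop :=
  forall (f : weight W) (F : sgraph),
    positive_in (subgraphon f) F <-> positive_in W F.

Definition weakly_random_EH (R : realType) (T : universal_theory) : Prop :=
  forall W : graphon R, graphon_of T W ->
    exists f : weight W, weakly_random (subgraphon f).

(* Main.v *)
(** If [T] does not have NIP, two applications of Ramsey's theorem to large
    shattered sets produce colours [a], [b] such that [T] contains every
    bipartite pattern with one side a clique (colour true) or independent
    (colour false) according to [a], the other according to [b].  Choosing the
    pattern to be an even cycle, or its bipartite complement when [a] and [b]
    are both true, yields cycles, complements of cycles, or cycles with one
    side turned into a clique: an infinite antichain [P 0, P 1, ...] of prime
    graphs in [T], with [#|P n| = 2 n + 8].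

    If moreover [T] is closed under substitution, it contains the iterated
    lexicographic products [P 0[P 1[... P n]]].  They converge to a graphon [W] on
    [0, 1[, where adjacency of two points is decided by the first digit at which
    their expansions in the mixed radix [#|P 0|, #|P 1|, ...] differ.  A
    subgraphon of [W] contains some [P n] with positive density, because the
    product of the [1 - 1 / #|P n|] is zero; but [P n] has density zero in the
    further subgraphon given by fixing the first [n + 1] digits, since a prime
    graph occurring there embeds in some [P m] with [m > n].  Hence no
    subgraphon of [W] is weakly random. *)

From HB Require Import structures.
Require Import Defs.
From mathcomp Require Import all_boot all_algebra zify boolp.

Set Implicit Arguments.
Unset Strict Implicit.
Unset Printing Implicit Defensive.
Import GRing.Theory.

(** * Prime graphs and Ramsey's theorem *)

Definition embedding (F G : sgraph) (h : F -> G) : Prop :=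
  injective h /\ forall x y, edge G (h x) (h y) = edge F x y.

Lemma card_induced (G : sgraph) (U : {set G}) : #|induced U| = #|U|.
Proof. by rewrite card_sig; apply: eq_card => x; rewrite inE. Qed.

Lemma embedding_iso (F G : sgraph) (h : F -> G) :
  embedding h -> iso F (induced (h @: [set: F])).
Proof.
move=> [h_inj h_edge].
have hU x : h x \in h @: [set: F] by rewrite imset_f ?inE.
exists (fun x => exist _ (h x) (hU x)); last by move=> x y; rewrite /= /induced_rel /=.
apply: inj_card_bij => [x y [/h_inj]//|].
by rewrite card_induced card_imset// cardsT.
Qed.

Lemma induced_leP (F G : sgraph) :
  induced_le F G <-> exists h : F -> G, embedding h.
Proof.
split=> [[U [f /bij_inj f_inj f_edge]]|[h /embedding_iso]]; last by exists (h @: [set: F]).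
exists (fun x => val (f x)); split=> [x y /val_inj/f_inj//|x y].
by rewrite -f_edge.
Qed.

Lemma iso_symm (F G : sgraph) : iso F G -> iso G F.
Proof.
move=> [f [g fK gK] f_edge]; exists g; first by exists f.
by move=> x y; rewrite -f_edge !gK.
Qed.

Lemma models_embedding (T : universal_theory) (F G : sgraph) (h : F -> G) :
  embedding h -> models T G -> models T F.
Proof.
move=> /embedding_iso/iso_symm FG TG.
exact: models_iso FG (models_induced _ TG).
Qed.

Definition is_module (F : sgraph) (M : {set F}) : Prop :=
  forall x y z, x \in M -> y \in M -> z \notin M -> edge F x z = edge F y z.

Lemma card_subst (F1 : sgraph) (v : F1) (F2 : sgraph) :
  #|subst v F2| = (#|F1|.-1 + #|F2|)%N.
Proof. rewrite card_sum card_sig -(cardC1 v); congr addn. Qed.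

(** A proper module with at least two vertices can be contracted to a representative, and
    substituting the graph on the module for that vertex recovers [F]. Conversely, the copy of [F2]
    inside [subst v F2] is such a module. *)
Lemma prime_graphP (F : sgraph) : prime_graph F <->
  forall M : {set F}, is_module M -> 1 < #|M| -> M = [set: F].
Proof.
split=> [F_prime M M_mod M_gt1|no_mod [F1 [v [F2 [lt1 lt2 [f f_bij f_edge]]]]]].
  apply/eqP; rewrite eqEcard subsetT cardsT leqNgt; apply/negP => M_lt.
  have /card_gt0P[r rM] : 0 < #|M| by exact: ltnW.
  pose U := r |: ~: M.
  have rU : r \in U by rewrite !inE eqxx.
  have cU : #|U| = (#|F| - #|M|).+1.
    by rewrite cardsU1 !inE rM /= [#|~: M|]cardsCs setCK.
  pose v : induced U := exist _ r rU.
  apply: F_prime; exists (induced U), v, (induced M); split.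
  - by rewrite card_induced cU; lia.
  - by rewrite card_induced.
  apply: iso_symm.
  pose f (a : subst v (induced M)) : F :=
    match a with inl x => val (val x) | inr y => val y end.
  have inlM (x : {x : induced U | x != v}) : val (val x) \notin M.
    case: x => -[x xU] /= xv; apply: contra xv => xM.
    by have := xU; rewrite -val_eqE /= !inE xM orbF.
  exists f.
    apply: inj_card_bij.
      move=> [x|x] [y|y] /= exy.
      - by congr inl; do 2!apply: val_inj.
      - by case/negP: (inlM x); rewrite (_ : val (val x) = val y) ?(valP y).
      - by case/negP: (inlM y); rewrite (_ : val (val y) = val x) ?(valP x).
      - by congr inr; exact: val_inj.
    by rewrite card_subst !card_induced cU; lia.
  have E (x : {x : induced U | x != v}) (y : induced M) :
      edge F (val y) (val (val x)) = edge F r (val (val x)).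
    exact: M_mod (valP y) rM (inlM x).
  have E' (x : {x : induced U | x != v}) (y : induced M) :
      edge F (val (val x)) (val y) = edge F (val (val x)) r.
    by rewrite edge_sym E edge_sym.
  by move=> [x|x] [y|y]; [|exact: E'|exact: E|].
have [g fK gK] := f_bij.
have cF := bij_eq_card f_bij; rewrite card_subst in cF.
have cM : #|[set g (inr y) | y in F2]| = #|F2|.
  by rewrite card_imset// => x y /(can_inj gK)[].
have : [set g (inr y) | y in F2] = [set: F].
  (* The bounds [lt1] and [lt2], together with [cF], force [F2] to have at least two vertices. *)
  apply: no_mod; last by rewrite cM; lia.
  move=> _ _ z /imsetP[x _ ->] /imsetP[y _ ->] zM.
  rewrite -!f_edge !gK; case fz: (f z) => [w|w] //.
  by move: zM; rewrite -(fK z) fz imset_f.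
by move=> /(congr1 (fun A : {set F} => #|A|)); rewrite cM cardsT; lia.
Qed.

(** Induction on [s + t]: the vertices other than [x] are split by their colour towards [x], and [x]
    extends a homogeneous set of colour [b] found inside [A b]. *)
Lemma ramsey (V : finType) (e : rel V) (U : {set V}) s t :
  symmetric e -> 2 ^ (s + t) <= #|U| ->
  exists (b : bool) (L : {set V}), [/\ L \subset U, (if b then s else t) <= #|L| &
    {in L &, forall x y, x != y -> e x y = b}].
Proof.
move=> e_sym; move: {2}(s + t) (leqnn (s + t)) => n.
elim: n s t U => [|n IH] [|s] [|t] U //= nst leU;
  do ?[by exists true, set0; rewrite sub0set; split=> // x; rewrite inE
     | by exists false, set0; rewrite sub0set; split=> // x; rewrite inE].
have U_gt0 : 0 < #|U| by rewrite (leq_trans _ leU) ?expn_gt0.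
have /card_gt0P[x xU] := U_gt0.
pose A b := [set y in U :\ x | e x y == b].
have cA : #|A true| + #|A false| + 1 = #|U|.
  rewrite (cardsD1 x U) xU addnC; congr addn.
  rewrite -(cardsID [set y | e x y] (U :\ x)); congr addn; apply: eq_card => y.
    by rewrite !inE eqb_id.
  by rewrite !inE eqbF_neg andbC andbA.
have A_U b : A b \subset U by apply/subsetP => y; rewrite !inE => /andP[/andP[]].
have extend b (L : {set V}) : L \subset A b ->
    {in L &, forall y z, y != z -> e y z = b} ->
    [/\ x |: L \subset U, #|x |: L| = #|L|.+1 &
    {in x |: L &, forall y z, y != z -> e y z = b}].
  move=> /subsetP LA Lb; split.
  - by rewrite subUset sub1set xU /=; apply/subsetP => y /LA; apply/subsetP: y.
  - by rewrite cardsU1; case: (boolP (x \in L)) => // /LA; rewrite !inE eqxx.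
  move=> y z /setU1P[->|yL] /setU1P[->|zL]; rewrite ?eqxx// => yz.
  - by have := LA _ zL; rewrite !inE => /andP[_ /eqP].
  - by have := LA _ yL; rewrite !inE e_sym => /andP[_ /eqP].
  - exact: Lb.
have eE : 2 ^ (s.+1 + t.+1) = 2 ^ (s + t.+1) + 2 ^ (s + t.+1).
  by rewrite addSn expnS mul2n addnn.
have [le1|gt1] := leqP (2 ^ (s + t.+1)) #|A true|.
  have [|[] [L [LA Ls Lb]]] := IH s t.+1 _ _ le1; first lia.
    have [? cL ?] := extend _ _ LA Lb.
    by exists true, (x |: L); rewrite cL ltnS.
  by exists false, L; split=> //; exact: subset_trans LA _.
(* The strict inequality [gt1] makes up for the vertex [x] itself. *)
have le2 : 2 ^ (s.+1 + t) <= #|A false|.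
  by rewrite addSnnS; lia.
have [|[] [L [LA Ls Lb]]] := IH s.+1 t _ _ le2; first lia.
  by exists true, L; split=> //; exact: subset_trans LA _.
have [? cL ?] := extend _ _ LA Lb.
by exists false, (x |: L); rewrite cL ltnS.
Qed.

(** * Universal bipartite patterns *)

(** Since [S] runs over all subsets, any bipartite pattern with right side ['I_m] and distinct left
    neighbourhoods is found by picking the [u S] for the prescribed neighbourhoods [S]. *)
Definition has_universal_pattern (a b : bool) (m : nat) (G : sgraph) : Prop :=
  exists (u : {set 'I_m} -> G) (v : 'I_m -> G),
    [/\ injective u /\ injective v, forall S j, u S != v j,
        forall S S', S != S' -> edge G (u S) (u S') = a,
        forall j j', j != j' -> edge G (v j) (v j') = b &
        forall S j, edge G (u S) (v j) = (j \in S)].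

Lemma has_universal_pattern_leq a b m n (G : sgraph) : m <= n ->
  has_universal_pattern a b n G -> has_universal_pattern a b m G.
Proof.
move=> mn [u [v [[u_inj v_inj] uv uu vv u_v]]].
have w_inj : injective (widen_ord mn) by move=> i j /(congr1 val) /= ij; exact: val_inj.
exists (fun S : {set 'I_m} => u (widen_ord mn @: S)), (fun j => v (widen_ord mn j)); split=> //.
- by split=> [S S' /u_inj/(imset_inj w_inj)//|j j' /v_inj/w_inj].
- by move=> S S' SS'; rewrite uu// (inj_eq (imset_inj w_inj)).
- by move=> j j' jj'; rewrite vv// (inj_eq w_inj).
- by move=> S j; rewrite u_v mem_imset.
Qed.

Lemma ex_injection (aT rT : finType) (A : {set rT}) : #|aT| <= #|A| ->
  exists2 f : aT -> rT, injective f & forall x, f x \in A.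
Proof.
move=> le_A; exists (fun x => enum_val (widen_ord le_A (enum_rank x))); last first.
  by move=> x; exact: enum_valP.
by move=> x y /enum_val_inj/(congr1 val) /= xy; apply/enum_rank_inj/val_inj.
Qed.

(** Ramsey applied to [U] leaves a homogeneous part large enough to be indexed by the subsets of
    ['I_n]. Shattering then supplies, for each [i], a vertex [w i] adjacent exactly to the sets
    containing [i], and a second use of Ramsey makes [m] of these homogeneous. *)
Lemma shattered_universal_pattern m : exists k, forall (G : sgraph) (U : {set G}),
  shattered U -> k <= #|U| -> exists a b, has_universal_pattern a b m G.
Proof.
(* [2 ^ (m + m)] is the Ramsey bound for the vertices [w i]; the successor gives [1 < n], used to
   keep the two sides disjoint. *)
pose n := (2 ^ (m + m)).+1.
exists (2 ^ (2 ^ n + 2 ^ n)) => G U /forallP U_sh.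
move=> /(ramsey (@edge_sym G)) [a [U' [/subsetP U'U le_U' U'a]]].
have [|e e_inj eU'] := @ex_injection {set 'I_n} G U'.
  by rewrite -cardsT -powersetT card_powerset cardsT card_ord; case: (a) le_U'.
have trace i : exists w, neighbours w :&: U == [set e S | S in [set S : {set 'I_n} | i \in S]].
  have /implyP/(_ _)/existsP := U_sh [set e S | S in [set S : {set 'I_n} | i \in S]].
  by apply; apply/subsetP => _ /imsetP[S _ ->]; exact/U'U/eU'.
have [w wP] := choice trace.
have w_e i S : edge G (w i) (e S) = (i \in S).
  have /setP/(_ (e S)) := eqP (wP i).
  by rewrite !inE (U'U _ (eU' S)) andbT (mem_imset _ _ e_inj) inE.
have w_inj : injective w.
  move=> i j wij; have := w_e j [set i]; rewrite -wij w_e !inE eqxx.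
  by move=> /esym/eqP.
have ew_sym : symmetric (fun i j => edge G (w i) (w j)).
  by move=> i j; rewrite edge_sym.
have [|b [L [_ le_L Lb]]] := @ramsey 'I_n _ setT m m ew_sym.
  by rewrite cardsT card_ord.
have [|f f_inj fL] := @ex_injection 'I_m 'I_n L.
  by rewrite card_ord; case: (b) le_L.
exists a, b, (fun S : {set 'I_m} => e (f @: S)), (fun j => w (f j)); split.
- by split=> [S S' /e_inj/(imset_inj f_inj)|j j' /w_inj/f_inj].
- move=> S j; apply/eqP => /esym wE.
  (* A vertex [w (f j)] lying in the homogeneous set would be related by the constant [a] to all
     other [e S']. Two sets avoiding [f j] force [a = false], and two sets containing it force
     [a = true]. *)
  have far S' : S' != f @: S -> (f j \in S') = a.
    move=> neS; rewrite -w_e wE U'a ?eU'// inj_eq// eq_sym//.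
  have n_gt1 : 1 < n by rewrite ltnS expn_gt0.
  have ne01 : set0 != [set~ f j].
    rewrite eq_sym -card_gt0 cardsC1 card_ord; lia.
  have neT1 : [set f j] != setT.
    by rewrite eqEcard cardsT card_ord cards1; apply/negP => /andP[_]; lia.
  have a0 : a = false.
    have [S0|/far] := eqVneq set0 (f @: S); last by rewrite inE => <-.
    by have := far [set~ f j]; rewrite -S0 eq_sym !inE eqxx => /(_ ne01) <-.
  have [S1|/far] := eqVneq [set f j] (f @: S); last by rewrite !inE eqxx a0.
  by have := far setT; rewrite -S1 eq_sym a0 inE => /(_ neT1).
- by move=> S S' SS'; rewrite U'a ?eU'// (inj_eq e_inj) (inj_eq (imset_inj f_inj)).
- by move=> j j' jj'; rewrite Lb// (inj_eq f_inj).
- by move=> S j; rewrite edge_sym w_e mem_imset.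
Qed.

(** Pigeonhole on the four colour pairs: patterns restrict to smaller sizes, so a pair that fails at
    one size fails at all larger ones, and the maximum of four failing sizes would admit no pattern
    at all. *)
Lemma not_NIP_universal_pattern (T : universal_theory) : ~ NIP T ->
  exists a b, forall m, exists2 G, models T G & has_universal_pattern a b m G.
Proof.
move=> nNIP.
have pattern m : exists a b G, models T G /\ has_universal_pattern a b m G.
  have [k kP] := shattered_universal_pattern m.
  apply: contrapT => npat; apply: nNIP; exists k => G TG.
  apply/bigmax_leqP => U U_sh; rewrite leqNgt; apply/negP => /ltnW/(kP _ _ U_sh).
  by move=> [a [b pat]]; apply: npat; exists a, b, G.
apply: contrapT => npat.
have bad a b : exists m, forall n G, m <= n -> models T G -> ~ has_universal_pattern a b n G.
  apply: contrapT => nbad; apply: npat; exists a, b => m; apply: contrapT => nG.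
  apply: nbad; exists m => n G mn TG /(has_universal_pattern_leq mn) pat.
  by apply: nG; exists G.
have [m mP] := choice (fun p => bad p.1 p.2).
have [a [b [G [TG]]]] := pattern (\max_(p : bool * bool) m p).
exact: mP (a, b) _ _ (leq_bigmax _) TG.
Qed.

(** * Prime antichains of modified cycles *)

Section Cycle.
Variable n : nat.
(** The order [2 n + 8] is even, so parity alternates along the cycle, and at least 8, so that fewer
    than 8 unit steps never return. The outer [.+2] gives the ring of integers modulo this order. *)
Local Notation Zn := 'I_(n.*2.+2.+4).+2.
Local Open Scope ring_scope.

Lemma small_natr_neq0 k : (0 < k < 8)%N -> (k%:R : Zn) != 0.
Proof.
move=> /andP[k0 k8]; rewrite -val_eqE /= Zp_nat /= modn_small; last by lia.
by rewrite -lt0n.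
Qed.

Lemma addr_natr_neq (x : Zn) k : (0 < k < 8)%N -> (x + k%:R == x) = false.
Proof.
by move=> /small_natr_neq0/negPf <-; rewrite -{2}[x]addr0 (inj_eq (addrI x)).
Qed.

Lemma odd_addr1 (x : Zn) : odd (x + 1)%R = ~~ odd x.
Proof. by rewrite /= odd_mod ?oddD ?odd_mod /= ?negbK ?odd_double // addbT. Qed.

Definition cyc (x y : Zn) : bool := (y == x + 1) || (x == y + 1).

Lemma cycC : symmetric cyc.
Proof. by move=> x y; rewrite /cyc orbC. Qed.

Lemma cyc_addr1 x : cyc x (x + 1).
Proof. by rewrite /cyc eqxx. Qed.

Lemma cyc_subr1 x : cyc x (x - 1).
Proof. by rewrite /cyc subrK eqxx orbT. Qed.

Lemma cyc_odd x y : cyc x y -> odd y = ~~ odd x.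
Proof. by move=> /orP[]/eqP->; rewrite odd_addr1 ?negbK. Qed.

Lemma cyc_neq x y : cyc x y -> x != y.
Proof. by move=> /cyc_odd; case: eqVneq => // ->; case: odd. Qed.

(** Distinct vertices of a cycle share both neighbours only if its length is 4. *)
Lemma cyc_nbhd_sub x y : (forall z, cyc x z -> cyc y z) -> x = y.
Proof.
move=> sub; have := sub _ (cyc_addr1 x); have := sub _ (cyc_subr1 x).
rewrite /cyc subrK => /orP[/eqP xE|/eqP-> //].
rewrite (inj_eq (addIr 1)) => /orP[/eqP-> //|/eqP yE].
have n4 : (x + (1 + (1 + (1 + 1))) == x) = false := @addr_natr_neq x 4 isT.
by move/eqP: xE; rewrite yE subr_eq -!addrA eq_sym n4.
Qed.

Lemma addr1_closed_setT (U : {set Zn}) x :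
  x \in U -> {in U, forall y, y + 1 \in U} -> U = [set: Zn].
Proof.
move=> xU U1; apply/setP => y; rewrite inE.
have UD k : x + k%:R \in U.
  by elim: k => [|k IH]; rewrite ?addr0// -natr1 addrA U1.
by have := UD (y - x); rewrite natr_Zp addrC subrK.
Qed.

(* The bipartite adjacency is complemented when both sides are cliques, so that
   [side_edge true true] is the complement of the cycle. *)
Definition side_edge (a b : bool) (x y : Zn) : bool :=
  (x != y) && (if odd x == odd y then if odd x then b else a
               else cyc x y (+) (a && b)).

Lemma side_edge_sym a b : symmetric (side_edge a b).
Proof.
move=> x y; rewrite /side_edge eq_sym cycC [odd y == _]eq_sym.
by case: (eqVneq (odd x)) => // ->.
Qed.

Lemma side_edge_irr a b : irreflexive (side_edge a b).
Proof. by move=> x; rewrite /side_edge eqxx. Qed.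

Definition side_cycle a b : sgraph := SGraph (@side_edge_sym a b) (@side_edge_irr a b).

Lemma card_side_cycle a b : #|side_cycle a b| = (n.*2 + 8)%N.
Proof. by rewrite card_ord; lia. Qed.

(** Neighbours on the cycle have opposite parity, so the rule inside a side agrees with the rule
    across: [c] selects the cycle or its complement. *)
Lemma side_edgeE c x y : edge (side_cycle c c) x y = (x != y) && (cyc x y (+) c).
Proof.
rewrite /= /side_edge andbb; case: eqVneq => //= xy.
case: (eqVneq (odd x)) => // oxy; rewrite if_same.
by have [/cyc_odd|//] := boolP (cyc x y); rewrite oxy; case: odd.
Qed.

Lemma split_edgeE (x y : side_cycle true false) :
  edge (side_cycle true false) x y = cyc x y || [&& x != y, ~~ odd x & ~~ odd y].
Proof.
rewrite /= /side_edge /= addbF.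
have [xy|nxy] := boolP (cyc x y).
  by rewrite (cyc_neq xy) (cyc_odd xy); case: odd.
by case: (x != y); case: (odd x); case: (odd y).
Qed.

(** A proper module has a boundary [x], with [x + 1] outside. Each of its vertices is then a cycle
    neighbour of [x + 1], so the module is [x] and [x + 2]; but [x - 1] distinguishes these two. *)
Lemma cycle_prime c : prime_graph (side_cycle c c).
Proof.
apply/prime_graphP => M M_mod M_gt1; apply: contrapT => MT.
have [x0 x0M] : exists x, x \in M by apply/card_gt0P; exact: ltnW.
have [x xM x1M] : exists2 x, x \in M & x + 1 \notin M.
  apply: contrapT => nx; apply/MT/(addr1_closed_setT x0M) => x xM.
  by apply: contrapT => x1; apply: nx; exists x => //; apply/negP.
have cyc_mod z w : w \in M -> z \notin M -> cyc w z = cyc x z.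
  move=> wM zM; have := M_mod w x z wM xM zM; rewrite !side_edgeE.
  have neq_z v : v \in M -> v != z by apply: contraTneq => ->.
  by rewrite !neq_z// => /addIb.
have ME w : w \in M -> (w == x) || (w == x + 1 + 1).
  move=> wM; have := cyc_mod _ _ wM x1M.
  by rewrite cyc_addr1 /cyc (inj_eq (addIr 1)) eq_sym.
have x2M : x + 1 + 1 \in M.
  have /card_gt0P[y] : (0 < #|M :\ x|)%N by move: M_gt1; rewrite (cardsD1 x) xM.
  rewrite !inE => /andP[/negPf yx yM].
  by have := ME y yM; rewrite yx => /eqP <-.
have n1 : (x == x - 1) = false.
  by rewrite -[X in X == _](subrK 1) (@addr_natr_neq (x - 1) 1).
have n2 : (x + (1 + 1) == x) = false := @addr_natr_neq x 2 isT.
have n3 : (x + 1 + 1 == x - 1) = false.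
  by have := @addr_natr_neq (x - 1) 3 isT; rewrite [3%:R](_ : _ = 1 + (1 + 1))// !addrA subrK.
have n4 : (x + 1 + 1 + 1 == x - 1) = false.
  by have := @addr_natr_neq (x - 1) 4 isT; rewrite [4%:R](_ : _ = 1 + (1 + (1 + 1)))// !addrA subrK.
have xm1M : x - 1 \notin M.
  by apply/negP => /ME; rewrite eq_sym n1 eq_sym n3.
have := cyc_mod _ _ x2M xm1M.
by rewrite cyc_subr1 /cyc subrK -[x + 1 + 1]addrA n2 orbF eq_sym addrA n4.
Qed.

(** Within one parity, the members of a module would share their cycle neighbours. If a module meets
    both parities, it absorbs the cycle neighbours of its even vertex [i]; an even [k] outside is
    adjacent to [i], hence to all of these, and so equals [i]. Once all even vertices are inside, an
    odd [b] outside would separate [b + 1] from the odd member [j]. *)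
Lemma split_cycle_prime : prime_graph (side_cycle true false).
Proof.
apply/prime_graphP => M M_mod M_gt1.
have /card_gt1P[x [y [xM yM xy]]] := M_gt1.
have [same|] := pselect (forall w, w \in M -> odd w = odd x).
  case/eqP: xy; apply: cyc_nbhd_sub => z xz.
  have zM : z \notin M.
    by apply/negP => /same; rewrite (cyc_odd xz); case: odd.
  have := M_mod x y z xM yM zM; rewrite !split_edgeE xz /= (same _ yM) (cyc_odd xz).
  by case: (odd x); rewrite /= ?andbF ?orbF => <-.
move=> /existsNP[w /not_implyP[wM /eqP wx]] {xy yM y}.
have [i [j [iM i_even jM j_odd]]] :
    exists i j, [/\ i \in M, ~~ odd i, j \in M & odd j].
  case: (boolP (odd x)) wx => [ox|ex].
    by rewrite eqb_id => ew; exists w, x.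
  by rewrite eqbF_neg negbK => ow; exists x, w.
have evenM (k : side_cycle true false) : ~~ odd k -> k \in M.
  move=> k_even; apply: contraT => kM.
  have ik : i != k by apply: contraNneq kM => <-.
  case/eqP: ik; apply: cyc_nbhd_sub => b ib.
  have b_odd : odd b by rewrite (cyc_odd ib).
  have bM : b \in M.
    apply: contraT => bM; have := M_mod i j b iM jM bM.
    rewrite !split_edgeE ib b_odd !andbF !orbF => /esym/cyc_odd.
    by rewrite j_odd b_odd.
  have := M_mod b i k bM iM kM; rewrite !split_edgeE b_odd i_even k_even /= andbF orbF andbT.
  rewrite (_ : i != k) ?orbT; last by apply: contraNneq kM => <-.
  by rewrite cycC.
apply/setP => b; rewrite inE; apply: contraT => bM.
have b_odd : odd b by apply: contraNT bM => /evenM.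
have b1M : b + 1 \in M by apply: evenM; rewrite odd_addr1 b_odd.
have := M_mod _ _ _ b1M jM bM; rewrite !split_edgeE cycC cyc_addr1 b_odd /= !andbF orbF.
by move=> /esym/cyc_odd; rewrite j_odd b_odd.
Qed.

End Cycle.

(** The two neighbours of [x] go to distinct neighbours of [h x], so one of them hits [h x + 1]; the
    image is closed under successor and [h] is onto. *)
Lemma card_eq_cyc_embedding m n (h : 'I_(m.*2.+2.+4).+2 -> 'I_(n.*2.+2.+4).+2) :
  injective h -> (forall x y, cyc x y -> cyc (h x) (h y)) -> m = n.
Proof.
move=> h_inj h_cyc.
have : h @: setT = setT.
  apply: (@addr1_closed_setT n _ (h 0%R)); first by rewrite imset_f ?inE.
  move=> _ /imsetP[x _ ->].
  have := h_cyc _ _ (cyc_addr1 x); have := h_cyc _ _ (cyc_subr1 x); rewrite /cyc.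
  move=> /orP[/eqP<- _|/eqP hx]; first by rewrite imset_f ?inE.
  move=> /orP[/eqP<-|/eqP hx']; first by rewrite imset_f ?inE.
  have /h_inj/eqP : h (x - 1)%R = h (x + 1)%R by apply: (addIr 1%R); rewrite -hx.
  have := @addr_natr_neq m (x - 1)%R 2 isT.
  by rewrite [2%:R%R](_ : _ = 1 + 1)%R// addrA subrK eq_sym => ->.
move=> /(congr1 (fun A : {set _} => #|A|)).
by rewrite card_imset// !cardsT !card_ord; lia.
Qed.

Lemma cycle_embedding m n c (h : side_cycle m c c -> side_cycle n c c) :
  embedding h -> m = n.
Proof.
move=> [h_inj h_edge]; apply: (card_eq_cyc_embedding h_inj) => x y xy.
have := h_edge x y; rewrite !side_edgeE xy (inj_eq h_inj) (cyc_neq xy).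
by rewrite !andTb => /addIb ->.
Qed.

(** Parity is preserved, which reduces the claim to cycles. An even [x] sent to an odd vertex would
    have three neighbours [x + 2], [x + 4], [x + 6] sent to only two places; an odd [x] sent to an
    even vertex would become adjacent to the image of its non-neighbour [x + 3]. *)
Lemma split_cycle_embedding m n
    (h : 'I_(m.*2.+2.+4).+2 -> 'I_(n.*2.+2.+4).+2) :
  @embedding (side_cycle m true false) (side_cycle n true false) h -> m = n.
Proof.
move=> [h_inj h_edge].
have h_even (x : 'I_(m.*2.+2.+4).+2) : ~~ odd x -> ~~ odd (h x).
  move=> x_even; apply/negP => hx_odd.
  have adj k : k \in [:: 2; 4; 6] ->
      (h (x + k%:R) == h x + 1)%R || (h (x + k%:R) == h x - 1)%R.
    move=> k246; have xk_even : ~~ odd (x + k%:R)%R.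
      move: k246; rewrite !inE => /or3P[]/eqP->;
      by rewrite -!natr1 !addrA ?addr0 !odd_addr1 !negbK.
    have := h_edge x (x + k%:R)%R; rewrite !split_edgeE hx_odd andbF orbF.
    rewrite x_even xk_even eq_sym addr_natr_neq ?orbT => [|]; last first.
      by move: k246; rewrite !inE => /or3P[]/eqP->.
    by rewrite /cyc => /orP[->//|]; rewrite -subr_eq eq_sym orbC => ->.
  have ne k l : k < l < 8 -> (h (x + k%:R)%R == h (x + l%:R)%R) = false.
    move=> /andP[kl l8]; rewrite (inj_eq h_inj) -(subnKC (ltnW kl)) natrD addrA eq_sym.
    by rewrite addr_natr_neq//; lia.
  have := adj 2 isT; have := adj 4 isT; have := adj 6 isT.
  have := ne 2 4 isT; have := ne 2 6 isT; have := ne 4 6 isT.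
  by move=> n46 n26 n24 /orP[]/eqP e6 /orP[]/eqP e4 /orP[]/eqP e2;
    move: n46 n26 n24; rewrite e6 e4 e2 eqxx.
have h_odd (x : 'I_(m.*2.+2.+4).+2) : odd x -> odd (h x).
  move=> x_odd; apply: contraT => hx_even.
  pose y := (x + 1 + 1 + 1)%R.
  have y_even : ~~ odd y by rewrite !odd_addr1 x_odd.
  have xy : x != y.
    by apply: contraNneq y_even => <-.
  have := h_edge x y; rewrite !split_edgeE hx_even h_even// (inj_eq h_inj) xy orbT x_odd andbF orbF.
  have n2 := @addr_natr_neq m x 2 isT; have n4 := @addr_natr_neq m x 4 isT.
  rewrite [2%:R%R](_ : _ = 1 + 1)%R// addrA in n2.
  rewrite [4%:R%R](_ : _ = 1 + (1 + (1 + 1)))%R// !addrA in n4.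
  by rewrite /cyc (inj_eq (addIr 1%R)) n2 [x == _]eq_sym n4.
have h_par (x : 'I_(m.*2.+2.+4).+2) : odd (h x) = odd x.
  by have [/h_odd//|/h_even/negPf] := boolP (odd x).
apply: (card_eq_cyc_embedding h_inj) => x y xy.
have := h_edge x y; rewrite !split_edgeE xy !h_par (cyc_odd xy).
by rewrite andbN andbF orbF.
Qed.

(** The two embeddings differ in which parity is placed on the [u] side. Having both lets unequal
    colours be put in the order [true], [false]. *)
Lemma universal_pattern_side_cycle a b n (G : sgraph) :
  has_universal_pattern a b (n.*2.+2.+4).+2 G ->
  (exists h : side_cycle n a b -> G, embedding h) /\
  (exists h : side_cycle n b a -> G, embedding h).
Proof.
move=> [u [v [[u_inj v_inj] uv uu vv u_v]]].
pose N (x : 'I_(n.*2.+2.+4).+2) := [set y | cyc x y (+) (a && b)].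
have N_inj : injective N.
  move=> x y /setP xy; apply: cyc_nbhd_sub => z.
  by have := xy z; rewrite !inE => /addIb ->.
have uv' S j : (u S == v j) = false by apply/negbTE/uv.
have vu' S j : (v j == u S) = false by rewrite eq_sym uv'.
split.
  exists (fun x : 'I__ => if odd x then v x else u (N x)); split=> [x y|x y].
    case: (odd x); case: (odd y).
    - exact: v_inj.
    - by move/eqP; rewrite vu'.
    - by move/eqP; rewrite uv'.
    - by move/u_inj/N_inj.
  rewrite /= /side_edge; case: (eqVneq x y) => [->|xy]; first by rewrite edge_irr.
  case: (odd x); case: (odd y) => /=.
  - by rewrite vv.
  - by rewrite edge_sym u_v inE cycC.
  - by rewrite u_v inE.
  - by rewrite uu// (inj_eq N_inj).
exists (fun x : 'I__ => if odd x then u (N x) else v x); split=> [x y|x y].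
  case: (odd x); case: (odd y).
  - by move/u_inj/N_inj.
  - by move/eqP; rewrite uv'.
  - by move/eqP; rewrite vu'.
  - exact: v_inj.
rewrite /= /side_edge; case: (eqVneq x y) => [->|xy]; first by rewrite edge_irr.
case: (odd x); case: (odd y) => /=.
- by rewrite uu// (inj_eq N_inj).
- by rewrite u_v inE andbC.
- by rewrite edge_sym u_v inE cycC andbC.
- by rewrite vv.
Qed.

(** Equal colours give cycles or their complements; unequal colours give the split cycles after a
    possible exchange of sides. The sizes are recorded because their linear growth makes the product
    of the [1 - 1 / #|P n|] vanish. *)
Lemma not_NIP_prime_antichain (T : universal_theory) : ~ NIP T ->
  exists P : nat -> sgraph,
    [/\ forall n, models T (P n), forall n, prime_graph (P n),
        forall m n, m <> n -> ~ induced_le (P m) (P n) &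
        forall n, #|P n| = (n.*2 + 8)%N].
Proof.
move=> /not_NIP_universal_pattern [a [b pat]].
have in_T n : models T (side_cycle n a b) /\ models T (side_cycle n b a).
  have [G TG /universal_pattern_side_cycle [[h hP] [h' h'P]]] := pat (n.*2.+2.+4).+2.
  by split; [exact: models_embedding hP TG|exact: models_embedding h'P TG].
have split_family : (forall n, models T (side_cycle n true false)) ->
    exists P : nat -> sgraph,
    [/\ forall n, models T (P n), forall n, prime_graph (P n),
        forall m n, m <> n -> ~ induced_le (P m) (P n) &
        forall n, #|P n| = (n.*2 + 8)%N].
  exists (fun n => side_cycle n true false); split=> //.
  - exact: split_cycle_prime.
  - by move=> m n mn /induced_leP [h /split_cycle_embedding].
  - by move=> n; exact: card_side_cycle.
have [ab|ab] := eqVneq a b; last first.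
  apply: split_family => n.
  by case: a b ab in_T {pat} => -[]// _ in_T; have [] := in_T n.
rewrite ab in in_T; exists (fun n => side_cycle n b b); split=> //.
- by move=> n; have [] := in_T n.
- by move=> n; exact: cycle_prime.
- by move=> m n mn /induced_leP [h /cycle_embedding].
- by move=> n; exact: card_side_cycle.
Qed.

Lemma primally_almost_finite_NIP (T : universal_theory) :
  primally_almost_finite T -> NIP T.
Proof.
move=> T_paf; apply: contrapT => /not_NIP_prime_antichain [P [TP P_prime P_anti _]].
by apply: T_paf; exists P; split=> //; exact: P_anti.
Qed.

(** * Lexicographic products *)

Section Lex.
Variables F1 F2 : sgraph.

Definition lex_rel : rel (F1 * F2) := fun p q =>
  if p.1 == q.1 then edge F2 p.2 q.2 else edge F1 p.1 q.1.

Lemma lex_sym : symmetric lex_rel.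
Proof. by move=> p q; rewrite /lex_rel eq_sym; case: eqP => _; rewrite edge_sym. Qed.

Lemma lex_irr : irreflexive lex_rel.
Proof. by move=> p; rewrite /lex_rel eqxx edge_irr. Qed.

Definition lex : sgraph := SGraph lex_sym lex_irr.

End Lex.

(** [F2] is substituted for the vertices of [F1] one at a time: in the stage [D S] the vertices in
    [S] are already blown up, and any other vertex is represented by its pair with [y0]. *)
Lemma models_lex (T : universal_theory) (F1 F2 : sgraph) : substitution_closed T ->
  models T F1 -> models T F2 -> 0 < #|F2| -> models T (lex F1 F2).
Proof.
move=> T_subst TF1 TF2 /card_gt0P[y0 _].
pose D (S : {set F1}) : {set lex F1 F2} := [set p | (p.1 \in S) || (p.2 == y0)].
suff TD (s : seq F1) : models T (induced (D [set x in s])).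
  have pD p : p \in D [set x in enum F1] by rewrite !inE mem_enum.
  pose g (p : lex F1 F2) : induced (D [set x in enum F1]) := exist _ p (pD p).
  apply: (@models_embedding T _ _ g _ (TD (enum F1))).
  by split=> [p q []|p q].
elim: s => [|v s IH].
  have D0 (p : induced (D [set x in [::]])) : (val p).2 = y0.
    by have := valP p; rewrite !inE => /eqP.
  pose g (p : induced (D [set x in [::]])) : F1 := (val p).1.
  apply: (@models_embedding T _ _ g _ TF1); split=> [p q pq|p q].
    by apply: val_inj; apply: injective_projections; rewrite ?D0.
  rewrite /g /= /induced_rel /= /lex_rel !D0.
  by case: eqP => [->|//]; rewrite !edge_irr.
have vD : (v, y0) \in D [set x in s] by rewrite !inE eqxx orbT.
pose r : induced (D [set x in s]) := exist _ (v, y0) vD.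
have pD (p : F1 * F2) : p \in D [set x in v :: s] -> p.1 != v -> p \in D [set x in s].
  by rewrite !inE => /orP[/orP[->//|->//]|->]; rewrite ?orbT.
(* The fibre over [v] goes to the new copy of [F2] and other points to themselves; by [fE] the two
   inner [inr] are defaults that are never reached. As [f] need not be onto, [v] may already occur
   in [s]. *)
pose f (p : induced (D [set x in v :: s])) : subst r F2 :=
  if (val p).1 == v then inr (val p).2
  else if insub (val p) is Some p' then
    if insub p' is Some p'' then inl p'' else inr (val p).2
  else inr (val p).2.
have fE p : (val p).1 != v -> exists2 z, f p = inl z & val (val z) = val p.
  move=> pv; rewrite /f (negPf pv).
  case: insubP => [p' _ p'E|]; last by rewrite pD// (valP p).
  case: insubP => [p'' _ p''E|]; first by exists p''; rewrite // p''E.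
  by rewrite negbK => /eqP p'r; rewrite -p'E p'r eqxx in pv.
have fE' p : (val p).1 == v -> f p = inr (val p).2 by rewrite /f => ->.
apply: (@models_embedding T _ _ f _ (T_subst _ r _ IH TF2)).
split=> p q.
  case: (boolP ((val p).1 == v)) => [pv|/fE [z -> zp]]; rewrite ?(fE' _ pv);
  case: (boolP ((val q).1 == v)) => [qv|/fE [w -> wq]]; rewrite ?(fE' _ qv) => //.
    by move=> [pq]; apply/val_inj/injective_projections; rewrite // (eqP pv) (eqP qv).
  by move=> [zw]; apply: val_inj; rewrite -zp -wq zw.
rewrite [RHS]/= /induced_rel /= /lex_rel.
case: (boolP ((val p).1 == v)) => [pv|pv]; rewrite ?(fE' _ pv);
case: (boolP ((val q).1 == v)) => [qv|qv]; rewrite ?(fE' _ qv) //=.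
- by rewrite (eqP pv) (eqP qv) eqxx.
- have [w -> wq] := fE _ qv.
  by rewrite /= /induced_rel /= /lex_rel wq (eqP pv) eq_sym (negPf qv).
- have [z -> zp] := fE _ pv.
  by rewrite /= /induced_rel /= /lex_rel zp (eqP qv) (negPf pv).
have [z -> zp] := fE _ pv; have [w -> wq] := fE _ qv.
by rewrite /= /induced_rel /= /lex_rel wq zp.
Qed.

From mathcomp Require Import all_boot all_order all_algebra.
From mathcomp Require Import all_classical all_reals all_analysis measurable_realfun.
From mathcomp Require Import zify ring lra.
(* Restores [induced], shadowed by a notation for charges. *)
Import Defs.

Import Order.TTheory GRing.Theory Num.Theory.
Import numFieldNormedType.Exports.

Local Open Scope classical_set_scope.
Local Open Scope ring_scope.

(** * Iterated integrals of step functions *)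

Section IteratedIntegral.
Context {R : realType} d (X : measurableType d) (mu : probability X R).

(* Unlike [ge0_le_integral], this does not require measurability, so iterated
   integrals can be compared with those of step functions directly. *)
Lemma le_integral_ge0 (f g : X -> \bar R) : (forall x, 0 <= f x)%E ->
  (forall x, f x <= g x)%E -> (\int[mu]_x f x <= \int[mu]_x g x)%E.
Proof.
move=> f0 fg; have g0 x : (0 <= g x)%E by exact: le_trans (f0 x) (fg x).
rewrite !ge0_integralTE//; apply: le_ereal_sup => _ [h hf <-].
by exists h => // x; exact: le_trans (hf x) (fg x).
Qed.

Lemma iterated_integral_ge0 n (g : n.-tuple X -> \bar R) :
  (forall t, 0 <= g t)%E -> (0 <= iterated_integral mu g)%E.
Proof.
by elim: n g => [|n IH] g g0 //=; apply: integral_ge0 => x _; exact: IH.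
Qed.

Lemma le_iterated_integral n (g h : n.-tuple X -> \bar R) : (forall t, 0 <= g t)%E ->
  (forall t, g t <= h t)%E -> (iterated_integral mu g <= iterated_integral mu h)%E.
Proof.
elim: n g h => [|n IH] g h g0 gh //=.
apply: le_integral_ge0 => x; first exact: iterated_integral_ge0.
exact: IH.
Qed.

Variables (V : finType) (p : X -> V).
Hypothesis p_meas : forall v, measurable (p @^-1` [set v]).

Definition mass (v : V) : R := fine (mu (p @^-1` [set v])).

Lemma mass_ge0 v : 0 <= mass v.
Proof. exact: fine_ge0. Qed.

Lemma massE v : (mass v)%:E = mu (p @^-1` [set v]).
Proof. by rewrite /mass fineK// fin_num_measure. Qed.

Lemma integral_step (g : V -> R) : (forall v, 0 <= g v) ->
  (\int[mu]_x (g (p x))%:E)%E = (\sum_v g v * mass v)%:E.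
Proof.
move=> g0.
have gE x : (g (p x))%:E = (\sum_v (g v)%:E * (\1_(p @^-1` [set v]) x)%:E)%E.
  rewrite (bigD1 (p x))//= indicE mem_set//= mule1 big1 ?adde0// => v vx.
  by rewrite indicE memNset ?mule0//= => /esym/eqP; rewrite (negPf vx).
under eq_integral do rewrite gE.
rewrite ge0_integral_sum//; last 2 first.
- move=> v; apply/measurable_EFinP/measurable_funM; first exact: measurable_cst.
  exact: measurable_indic.
- by move=> v x _; rewrite mule_ge0// lee_fin.
rewrite -sumEFin; apply: eq_bigr => v _.
rewrite ge0_integralZl//; last 2 first.
- by apply/measurable_EFinP/measurable_indic.
- by rewrite lee_fin.
by rewrite integral_indic// setIT EFinM massE.
Qed.

Lemma sum_mass : \sum_v mass v = 1.
Proof.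
apply: EFin_inj; under eq_bigr do rewrite -[mass _]mul1r.
rewrite -(@integral_step (fun=> 1))// integral_cst// mul1e.
exact: probability_setT.
Qed.

(** Only the cells of the coordinates matter, so this is an expectation over [n] independent cells
    distributed by [mass]. *)
Lemma iterated_integral_step n (g : n.-tuple V -> R) : (forall s, 0 <= g s) ->
  iterated_integral mu (fun t => (g (map_tuple p t))%:E) =
  (\sum_(s : n.-tuple V) g s * \prod_(i < n) mass (tnth s i))%:E.
Proof.
elim: n g => [|n IH] g g0 /=.
  rewrite (big_pred1 [tuple]) ?big_ord0 ?mulr1; last first.
    by move=> s; apply/esym/eqP; exact: tuple0.
  by congr (g _)%:E; apply: val_inj.
pose g' v := \sum_(s : n.-tuple V) g [tuple of v :: s] * \prod_(i < n) mass (tnth s i).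
transitivity (\int[mu]_x (g' (p x))%:E)%E.
  apply: eq_integral => x _; rewrite /g' -IH => [|s]; last exact: g0.
  congr iterated_integral; apply/funext => t.
  by congr (g _)%:E; apply: val_inj.
rewrite integral_step => [|v]; last first.
  apply: sumr_ge0 => s _; rewrite mulr_ge0// prodr_ge0// => i _; exact: mass_ge0.
congr EFin; rewrite (eq_bigr (fun v => \sum_(s : n.-tuple V)
    g [tuple of v :: s] * \prod_(i < n) mass (tnth s i) * mass v)); last first.
  by move=> v _; rewrite mulr_suml.
rewrite pair_big /= (reindex (fun vs : V * n.-tuple V => [tuple of vs.1 :: vs.2])) /=.
  apply: eq_bigr => -[v s] _ /=; rewrite big_ord_recl tnth0 -mulrA; congr (_ * _).
  by rewrite mulrC; congr (_ * _); apply: eq_bigr => i _; rewrite tnthS.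
exists (fun t => (thead t, [tuple of behead t])) => [[v s] _|t _] /=.
  by rewrite theadE; congr pair; apply: val_inj.
by rewrite [RHS]tuple_eta; apply: val_inj.
Qed.

End IteratedIntegral.

(** * Mixed radix expansions *)

Section Truncn.
Variable R : realType.

(** This makes successive levels consistent: dropping the last digit of a numeral leaves the numeral
    of the previous level. *)
Lemma truncn_divn (y : R) q : 0 <= y -> (0 < q)%N ->
  Num.truncn y = (Num.truncn (y * q%:R) %/ q)%N.
Proof.
move=> y0 q0; apply: truncn_def.
have yq0 : 0 <= y * q%:R by rewrite mulr_ge0.
have q0' : (0 : R) < q%:R by rewrite ltr0n.
have /andP[l1 l2] := truncn_itv yq0; move: (Num.truncn _) l1 l2 => a l1 l2.
rewrite -(ler_pM2r q0') -(ltr_pM2r q0') -!natrM; apply/andP; split.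
  by apply: le_trans l1; rewrite ler_nat leq_trunc_div.
by apply: lt_le_trans l2 _; rewrite ler_nat ltn_ceil.
Qed.

Lemma measurable_truncn (a : R) (P : nat -> Prop) : 0 < a ->
  measurable [set x : R | P (Num.truncn (x * a))].
Proof.
move=> a0.
have mle k : measurable [set x : R | (Num.truncn (x * a) <= k)%N].
  rewrite (_ : mkset _ = `]-oo, k.+1%:R / a[%classic) //.
  by apply/seteqP; split=> x /=; rewrite in_itv /= truncn_le_nat ltr_pdivlMr.
have meq k : measurable [set x : R | Num.truncn (x * a) = k].
  case: k => [|k].
    rewrite (_ : mkset _ = [set x | (Num.truncn (x * a) <= 0)%N]) //.
    by apply/seteqP; split=> x /=; [move=> ->|rewrite leqn0 => /eqP].
  rewrite (_ : mkset _ = [set x | (Num.truncn (x * a) <= k.+1)%N] `\`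
                         [set x | (Num.truncn (x * a) <= k)%N]).
    exact: measurableD.
  apply/seteqP; split=> x /=.
    by move=> ->; split=> //; rewrite ltnn.
  by move=> [l1 /negP]; rewrite -ltnNge => l2; apply/eqP; rewrite eqn_leq l1.
rewrite (_ : mkset _ = \bigcup_(k in P) [set x | Num.truncn (x * a) = k]).
  by apply: bigcup_measurable => k _.
apply/seteqP; split=> x /=; first by move=> Px; exists (Num.truncn (x * a)).
by move=> [k Pk /= ->].
Qed.

(** The points are all reals, with the mass concentrated on [[0, 1[], where addresses are mixed
    radix expansions. *)
Definition unif01 := mrestr (@lebesgue_measure R) (measurable_itv `[(0 : R), 1[).

HB.instance Definition _ := Measure.on unif01.

Fact unif01_setT : unif01 setT = 1%E.
Proof.
by rewrite /unif01 /mrestr setTI lebesgue_measure_itv /= lte_fin ltr01 sube0.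
Qed.

HB.instance Definition _ := @Measure_isProbability.Build _ _ R unif01 unif01_setT.

End Truncn.

Definition point_graph : sgraph :=
  @SGraph unit (fun _ _ => false) (fun _ _ => erefl) (fun _ => erefl).

Section Levels.
Variables (Q : nat -> sgraph) (Q_gt0 : forall n, (0 < #|Q n|)%N).

Fixpoint level n : sgraph :=
  if n is m.+1 then lex (level m) (Q m) else point_graph.

Lemma card_levelS n : #|level n.+1| = (#|level n| * #|Q n|)%N.
Proof. by rewrite card_prod. Qed.

Lemma card_level_gt0 n : (0 < #|level n|)%N.
Proof. by elim: n => [|n IH]; rewrite ?card_unit// card_levelS muln_gt0 IH Q_gt0. Qed.

(** The address read as a mixed radix numeral, which is the position of its interval among the
    [#|level n|] equal intervals of [[0, 1[]. *)
Fixpoint code n : level n -> nat :=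
  if n is m.+1 return level n -> nat
  then fun v : level m * Q m => (code v.1 * #|Q m| + enum_rank v.2)%N
  else fun=> 0%N.

Lemma code_lt n (v : level n) : (code v < #|level n|)%N.
Proof.
elim: n v => [|n IH] /=; first by rewrite card_unit.
move=> [v c]; rewrite [X in (_ < X)%N]card_levelS /=.
have c_lt : (enum_rank c < #|Q n|)%N := ltn_ord (enum_rank c).
apply: (@leq_trans ((code v).+1 * #|Q n|)); first by rewrite mulSnr ltn_add2l.
by rewrite leq_mul2r IH orbT.
Qed.

Variable R : realType.

Definition digit n (x : R) : Q n :=
  enum_val (Ordinal (ltn_pmod (Num.truncn (x * #|level n.+1|%:R)) (Q_gt0 n))).

Fixpoint address n (x : R) : level n :=
  if n is m.+1 return level n then (address m x, digit m x) else tt.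

Lemma address_code n (x : R) (v : level n) : 0 <= x < 1 ->
  address n x = v <-> Num.truncn (x * #|level n|%:R) = code v.
Proof.
move=> /andP[x0 x1]; elim: n v => [|n IH] /=.
  move=> []; split=> // _; rewrite card_unit mulr1.
  by apply/truncn0Pn; rewrite -ltNge.
move=> [v c] /=.
have card1 : #|level n.+1|%:R = #|level n|%:R * #|Q n|%:R :> R.
  by rewrite card_levelS natrM.
have := @truncn_divn R (x * #|level n|%:R) #|Q n|; rewrite -mulrA -card1.
rewrite mulr_ge0 // => /(_ isT (Q_gt0 n)) tE.
rewrite /digit; set t := Num.truncn (x * #|level n.+1|%:R) in tE *.
have digitE : enum_val (Ordinal (ltn_pmod t (Q_gt0 n))) = c <->
    (t %% #|Q n|)%N = enum_rank c.
  split=> [<-|tc]; first by rewrite enum_valK.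
  by apply: (can_inj enum_rankK); rewrite enum_valK; apply: val_inj.
have := IH v; rewrite tE => IHv; split=> [[/IHv v1 /digitE c1]|tvc].
  by rewrite (divn_eq t #|Q n|) v1 c1.
have c_lt : (enum_rank c < #|Q n|)%N := ltn_ord (enum_rank c).
congr pair; first by apply/IHv; rewrite tvc divnMDl// divn_small// addn0.
by apply/digitE; rewrite tvc modnMDl modn_small.
Qed.

Lemma measurable_address n (v : level n) : measurable (@address n @^-1` [set v]).
Proof.
elim: n v => [|n IH] /=; first by case; rewrite (_ : _ @^-1` _ = setT)//; apply/seteqP.
move=> [v c].
rewrite (_ : _ @^-1` _ = (@address n @^-1` [set v]) `&` [set x | digit n x = c]).
  apply: measurableI; first exact: IH.
  apply: (@measurable_truncn R #|level n.+1|%:R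
    (fun t => enum_val (Ordinal (ltn_pmod t (Q_gt0 n))) = c)).
  by rewrite ltr0n card_level_gt0.
by apply/seteqP; split=> x /= [-> ->].
Qed.

Lemma unif01_address n (v : level n) :
  unif01 (@address n @^-1` [set v]) = (#|level n|%:R^-1)%:E :> \bar R.
Proof.
have N0 : (0 : R) < #|level n|%:R by rewrite ltr0n card_level_gt0.
rewrite /unif01 /mrestr /=.
rewrite (_ : _ `&` _ = `[(code v)%:R / #|level n|%:R, (code v).+1%:R / #|level n|%:R[%classic).
  rewrite lebesgue_measure_itv /= lte_fin ltr_pM2r ?invr_gt0// ltr_nat ltnSn.
  by rewrite -EFinB -mulrBl -natrB// subSnn mul1r.
apply/seteqP; split=> x /=; rewrite !in_itv /=.
  move=> [xv x01]; rewrite ler_pdivrMr// ltr_pdivlMr//.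
  have /andP[x0 _] := x01; have /address_code := x01 => /(_ _ v)[/(_ xv) <- _].
  by apply: truncn_itv; rewrite mulr_ge0.
move=> /andP[lx xl].
have x01 : 0 <= x < 1.
  rewrite (le_trans _ lx) ?divr_ge0//=; apply: (lt_le_trans xl).
  by rewrite ler_pdivrMr// mul1r ler_nat code_lt.
split=> //; apply/address_code => //; apply: truncn_def.
by rewrite -ler_pdivrMr// -ltr_pdivlMr// lx.
Qed.

End Levels.

(** * The limit graphon *)

Definition induces (F : sgraph) (V : Type) (e : rel V) (t : #|F|.-tuple V) : bool :=
  [forall i : 'I_#|F|, forall j : 'I_#|F|, (i < j)%N ==>
     (edge F (enum_val i) (enum_val j) == e (tnth t i) (tnth t j))].

Lemma inducesP (F : sgraph) (V : Type) (e : rel V) (t : #|F|.-tuple V) :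
  symmetric e ->
  reflect (forall i j, i != j ->
      edge F (enum_val i) (enum_val j) = e (tnth t i) (tnth t j)) (induces e t).
Proof.
move=> e_sym; apply: (iffP forallP) => [eP i j|eP i].
  rewrite neq_ltn => /orP[] ij; last rewrite edge_sym e_sym.
    by have /forallP/(_ j)/implyP/(_ ij)/eqP := eP i.
  by have /forallP/(_ i)/implyP/(_ ij)/eqP := eP j.
by apply/forallP => j; apply/implyP => ij; rewrite eP// neq_ltn ij.
Qed.

Lemma prodr_nat_of_bool (R : realType) (I : finType) (P b : pred I) :
  \prod_(i | P i) (b i)%:R = [forall i, P i ==> b i]%:R :> R.
Proof.
have [/forallP Pb|/forallPn[i]] := boolP [forall i, P i ==> b i].
  by rewrite big1// => i Pi; have := Pb i; rewrite Pi /= => ->.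
by rewrite negb_imply => /andP[Pi /negPf bi]; rewrite (bigD1 i)//= bi mul0r.
Qed.

Lemma ind_densityE (R : realType) (F : sgraph) (W : graphon R) (e : rel (gspace W)) :
  (forall x y, W x y = (e x y)%:R) ->
  ind_density F W =
  iterated_integral (gprob W) (fun t : #|F|.-tuple (gspace W) => ((induces e t)%:R)%:E).
Proof.
move=> WE; rewrite /ind_density; congr iterated_integral; apply/funext => t; congr EFin.
rewrite /induces -(prodr_nat_of_bool R predT (fun i => [forall j, _])).
apply: eq_bigr => i _; rewrite -prodr_nat_of_bool; apply: eq_bigr => j _; rewrite WE.
by case: (edge F _ _); case: (e _ _); rewrite ?subrr ?subr0.
Qed.

Lemma card_ind_embeddings (F G : sgraph) :
  #|[set s : #|F|.-tuple G | induces (edge G) s && uniq s]%SET| = #|ind_embeddings F G|.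
Proof.
pose h (s : #|F|.-tuple G) : {ffun F -> G} := [ffun x => tnth s (enum_rank x)].
have h_inj : injective h.
  move=> s t /ffunP st; apply: eq_from_tnth => i.
  by have := st (enum_val i); rewrite !ffunE enum_valK.
rewrite -(card_imset _ h_inj); apply: eq_card => g.
apply/imsetP/idP => [[s]|]; rewrite !inE.
  move=> /andP[/inducesP s_ind /tuple_uniqP s_inj] ->; apply/andP; split.
    by apply/injectiveP => x y; rewrite !ffunE => /s_inj/enum_rank_inj.
  apply/forallP => x; apply/forallP => y; rewrite !ffunE.
  have [->|xy] := eqVneq x y; first by rewrite !edge_irr.
  rewrite -s_ind ?enum_rankK//; first exact: edge_sym.
  by rewrite (inj_eq enum_rank_inj).
move=> /andP[/injectiveP g_inj /forallP g_edge].
have gE i : tnth [tuple g (enum_val i) | i < #|F|] i = g (enum_val i) by rewrite tnth_mktuple.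
exists [tuple g (enum_val i) | i < #|F|].
  rewrite inE; apply/andP; split.
    apply/inducesP; first exact: edge_sym.
    move=> i j _; rewrite !tnth_mktuple.
    by have /forallP/(_ (enum_val j))/eqP := g_edge (enum_val i).
  by rewrite map_inj_uniq ?enum_uniq// => i j /g_inj/enum_val_inj.
by apply/ffunP => x; rewrite ffunE tnth_mktuple enum_rankK.
Qed.

Section LimitGraphon.
Variables (Q : nat -> sgraph) (Q_gt0 : forall n, (0 < #|Q n|)%N) (R : realType).
Local Notation X := (measurableTypeR R).
Local Notation address := (@address Q Q_gt0 R).

Let address_meas n (v : level Q n) : measurable (address n @^-1` [set v] : set X).
Proof. exact: measurable_address. Qed.

Definition limit_rel : rel X :=
  fun x y => `[< exists n, edge (level Q n) (address n x) (address n y) >].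

Lemma limit_rel_sym : symmetric limit_rel.
Proof. by move=> x y; apply/asboolP/asboolP => -[n]; exists n; rewrite edge_sym. Qed.

(** Adjacency is settled at the first differing digit and inherited by all later levels, so it may
    be read at any level that separates [x] and [y]. *)
Lemma limit_relE n x y : address n x != address n y ->
  limit_rel x y = edge (level Q n) (address n x) (address n y).
Proof.
have up m k : address m x != address m y ->
    address (m + k) x != address (m + k) y /\
    edge (level Q (m + k)) (address (m + k) x) (address (m + k) y) =
    edge (level Q m) (address m x) (address m y).
  move=> mxy; elim: k => [|k [neq IH]]; first by rewrite addn0.
  rewrite addnS /= /lex_rel /= (negPf neq) IH; split=> //.
  by rewrite xpair_eqE (negPf neq).
move=> nxy; apply/asboolP/idP => [[m mxy]|]; last by exists n.
have mneq : address m x != address m y.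
  by apply: contraTneq mxy => ->; rewrite edge_irr.
have [/subnKC mn|/ltnW/subnKC nm] := leqP m n.
  by have [_] := up m (n - m)%N mneq; rewrite mn => ->.
by have [_] := up n (m - n)%N nxy; rewrite nm => <-.
Qed.

Lemma limit_rel_range x y : 0 <= ((limit_rel x y)%:R : R) <= 1.
Proof. by case: limit_rel; rewrite ?ler01 lexx. Qed.

Lemma limit_rel_meas :
  measurable_fun [set: X * X] (fun p => (limit_rel p.1 p.2)%:R : R).
Proof.
pose E := \bigcup_n [set p : X * X |
  edge (level Q n) (address n p.1) (address n p.2)].
rewrite (_ : (fun p => _) = \1_E); last first.
  apply/funext => p; rewrite indicE; congr (nat_of_bool _)%:R.
  apply/asboolP/idP; rewrite inE; first by move=> [n nP]; exists n.
  by move=> [n _ nP]; exists n.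
apply: measurable_indic; apply: bigcup_measurable => n _.
rewrite (_ : mkset _ = \bigcup_(q in [set q : level Q n * level Q n | edge (level Q n) q.1 q.2])
    ((address n @^-1` [set q.1]) `*` (address n @^-1` [set q.2]))).
  apply: fin_bigcup_measurable => [|q _]; first exact: finite_finset.
  by apply: measurableX; exact: measurable_address.
apply/seteqP; split=> [p /= pE|p [q /= qE [/= -> ->]]] //.
by exists (address n p.1, address n p.2).
Qed.

Definition limit_graphon (nu : probability X R) : graphon R :=
  @Graphon R _ X nu (fun x y => (limit_rel x y)%:R)
    (fun x y => congr1 (fun b : bool => b%:R) (limit_rel_sym x y))
    limit_rel_range limit_rel_meas.

Lemma ind_density_limit (nu : probability X R) (F : sgraph) :
  ind_density F (limit_graphon nu) =
  iterated_integral nu (fun t : #|F|.-tuple X => ((induces limit_rel t)%:R)%:E).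
Proof. exact: ind_densityE. Qed.

Lemma induces_address n (F : sgraph) (t : #|F|.-tuple X) :
  uniq (map_tuple (address n) t) ->
  induces limit_rel t = induces (edge (level Q n)) (map_tuple (address n) t).
Proof.
move=> /tuple_uniqP t_inj.
apply/(inducesP _ limit_rel_sym)/(inducesP _ (@edge_sym _)) => tP i j ij.
- rewrite !tnth_map -limit_relE ?tP//.
  by move: ij; rewrite -(inj_eq t_inj) !tnth_map.
- rewrite (@limit_relE n) ?tP ?tnth_map//.
  by move: ij; rewrite -(inj_eq t_inj) !tnth_map.
Qed.

Local Notation mass nu n := (mass nu (@address n)).

(** One sample in each child of [v], in the order of the vertices, already forms [Q n]; this happens
    with probability the product of the masses. *)
Lemma positive_of_children (nu : probability X R) n (v : level Q n) :
  (forall c : Q n, 0 < mass nu n.+1 (v, c)) ->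
  positive_in (limit_graphon nu) (Q n).
Proof.
move=> m_gt0; rewrite /positive_in ind_density_limit.
pose s0 : #|Q n|.-tuple (level Q n.+1) := [tuple (v, enum_val i) | i < #|Q n|].
have s0_uniq : uniq s0.
  by rewrite map_inj_uniq ?enum_uniq// => i j [] /enum_val_inj.
have s0_ind : induces (edge (level Q n.+1)) s0.
  apply/inducesP; first exact: edge_sym.
  by move=> i j _; rewrite !tnth_mktuple /= /lex_rel /= eqxx.
pose g (s : #|Q n|.-tuple (level Q n.+1)) : R := (s == s0)%:R.
have g_ge0 s : 0 <= g s by [].
apply: lt_le_trans (_ : (iterated_integral nu
  (fun t => (g (map_tuple (address n.+1) t))%:E) <= _)%E); last first.
  apply: le_iterated_integral => t; rewrite lee_fin//.
  rewrite /g; case: eqP => // ts0.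
  by rewrite (@induces_address n.+1) ts0 ?s0_ind.
rewrite (@iterated_integral_step _ _ X nu _ _ (@address_meas n.+1))// lte_fin.
rewrite (bigD1 s0)//= /g eqxx mul1r [X in _ + X]big1 => [|s ss0]; last by rewrite (negPf ss0) mul0r.
rewrite addr0; apply: prodr_gt0 => i _; rewrite tnth_mktuple; exact: m_gt0.
Qed.

Section Antichain.
Hypothesis Q_prime : forall n, prime_graph (Q n).
Hypothesis Q_anti : forall m n, m <> n -> ~ induced_le (Q m) (Q n).
Hypothesis Q_gt2 : forall n, (2 < #|Q n|)%N.

(** At a level [M > n] up to which the copy is not separated, the digits define a map to [Q M]. It
    is not injective, by the antichain condition, so some fibre is a module with two vertices, and
    primality makes the map constant. Hence the copy is never separated. *)
Lemma no_copy_in_cylinder n (v : level Q n.+1) (x : Q n -> X) :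
  (forall a, address n.+1 (x a) = v) ->
  ~ (forall a b, edge (Q n) a b = limit_rel (x a) (x b)).
Proof.
move=> xv xE.
have const m a b : address (n.+1 + m) (x a) = address (n.+1 + m) (x b).
  elim: m a b => [|m IH] a0 b0; first by rewrite addn0 !xv.
  rewrite addnS; move: (n.+1 + m)%N (leq_addr m n.+1) IH => M nM IH.
  apply/eqP; apply: contraT => neq.
  pose d a := digit Q_gt0 M (x a).
  have dE a b : d a != d b -> edge (Q n) a b = edge (Q M) (d a) (d b).
    move=> dab; rewrite xE (@limit_relE M.+1); last by apply: contraNneq dab => -[_ /eqP].
    by rewrite /= /lex_rel /= (IH a b) eqxx.
  have d0 : d a0 != d b0.
    by apply: contraNneq neq => /= dab; rewrite xpair_eqE (IH a0 b0) eqxx; apply/eqP.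
  have [d_inj|/injectivePn[a [b ab dab]]] := boolP (injectiveb d).
    have [] : ~ induced_le (Q n) (Q M) by apply: Q_anti; lia.
    apply/induced_leP; exists d; split; first exact/injectiveP.
    move=> a b; have [->|ab] := eqVneq a b; first by rewrite !edge_irr.
    by rewrite dE// (inj_eq (injectiveP _ d_inj)).
  have D_mod : is_module [set c | d c == d a]%SET.
    move=> y z w; rewrite !inE => /eqP dy /eqP dz dw.
    by rewrite !dE ?dy ?dz// eq_sym.
  have D_gt1 : (1 < #|[set c | d c == d a]%SET|)%N.
    by apply/card_gt1P; exists a, b; rewrite !inE eqxx dab eqxx.
  have /setP DT := proj1 (prime_graphP _) (@Q_prime n) _ D_mod D_gt1.
  have := DT a0; have := DT b0; rewrite !inE => /eqP db0 /eqP da0.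
  by rewrite da0 db0 eqxx in d0.
(* Points with equal addresses at all levels are non-adjacent, but in an edgeless graph with more
   than two vertices any pair is a proper module. *)
have noedge a b : edge (Q n) a b = false.
  rewrite xE; apply/asboolP => -[m].
  have [mn|/ltnW/subnKC nm] := leqP n.+1 m.
    by rewrite -(subnKC mn) (const _ a b) edge_irr.
  have lower k : address k (x a) = address k (x b) ->
      forall l, (l <= k)%N -> address l (x a) = address l (x b).
    elim: k => [|k IH] /= ek l; first by rewrite leqn0 => /eqP ->.
    by rewrite leq_eqVlt => /orP[/eqP->//|]; case: ek => ek _; exact: IH.
  rewrite (lower n.+1 _ m) ?edge_irr ?xv//; lia.
have /card_gt1P[a [b [_ _ ab]]] : (1 < #|Q n|)%N by exact: ltnW.
have ab_mod : is_module [set a; b]%SET by move=> y z w _ _ _; rewrite !noedge.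
have ab_gt1 : (1 < #|[set a; b]%SET|)%N by rewrite cards2 ab.
have abT := proj1 (prime_graphP _) (@Q_prime n) _ ab_mod ab_gt1.
by have := Q_gt2 n; rewrite -cardsT -abT cards2 ab.
Qed.

(** A copy of [Q n] requires some sample outside the cylinder of [v], which is a null event. *)
Lemma not_positive_in_cylinder (nu : probability X R) n (v : level Q n.+1) :
  (forall w, w != v -> mass nu n.+1 w = 0) ->
  ~ positive_in (limit_graphon nu) (Q n).
Proof.
move=> m0; rewrite /positive_in ind_density_limit.
pose g (s : #|Q n|.-tuple (level Q n.+1)) : R := (~~ all (pred1 v) s)%:R.
have g_ge0 s : 0 <= g s by [].
suff : (iterated_integral nu (fun t : #|Q n|.-tuple X => ((induces limit_rel t)%:R)%:E) <=
    iterated_integral nu (fun t => (g (map_tuple (address n.+1) t))%:E))%E.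
  rewrite (@iterated_integral_step _ _ X nu _ _ (@address_meas n.+1))// big1 => [|s _].
    by move=> le0 /lt_le_trans/(_ le0); rewrite ltxx.
  rewrite /g; have [|/allPn[w /tnthP[i ->] /m0 mi]] := boolP (all _ s); first by rewrite mul0r.
  by rewrite mul1r (bigD1 i)//= mi mul0r.
apply: le_iterated_integral => t; rewrite lee_fin// /g.
have [/allP tv|_] := boolP (all _ _); last by rewrite lern1 leq_b1.
case: (boolP (induces _ t)) => // /inducesP t_ind.
case: (@no_copy_in_cylinder n v (fun a => tnth t (enum_rank a))) => [a|a b].
  apply/eqP; have := tv (tnth (map_tuple (address n.+1) t) (enum_rank a)).
  by rewrite tnth_map; apply; rewrite -tnth_map mem_tnth.
have [->|ab] := eqVneq a b.
  by rewrite edge_irr; apply/esym/asboolP => -[m]; rewrite edge_irr.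
rewrite -t_ind ?enum_rankK//; first exact: limit_rel_sym.
by rewrite (inj_eq enum_rank_inj).
Qed.

End Antichain.
End LimitGraphon.

(** * Positive densities and convergence of the finite levels *)

Section Limit.
Variables (Q : nat -> sgraph) (Q_gt0 : forall n, (0 < #|Q n|)%N) (R : realType).
Local Notation X := (measurableTypeR R).
Local Notation address := (@address Q Q_gt0 R).
Local Notation mass nu n := (mass nu (@address n)).

Lemma mass_unif01 n (v : level Q n) : mass (@unif01 R) n v = #|level Q n|%:R^-1.
Proof. by have /(congr1 fine) := @unif01_address Q Q_gt0 R n v. Qed.

Lemma mass_parent (nu : probability X R) n (v : level Q n) (c : Q n) :
  mass nu n.+1 (v, c) <= mass nu n v.
Proof.
rewrite -lee_fin !massE; try by move=> w; exact: measurable_address.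
apply: le_measure; rewrite ?inE; try exact: measurable_address.
by move=> x /= [->].
Qed.

Lemma prod_card_level n :
  \prod_(j < n) (#|Q j|.-1%:R / #|Q j|%:R : R) =
  (\prod_(j < n) #|Q j|.-1)%N%:R / #|level Q n|%:R.
Proof.
elim: n => [|n IH]; first by rewrite !big_ord0 card_unit divr1.
rewrite !big_ord_recr /= IH card_levelS !natrM invfM; ring.
Qed.

(* Were all densities zero, every cylinder of level n would have a null child,
   so nu would live on a set of Lebesgue measure at most prod (1 - 1 / #|Q j|). *)
Lemma some_positive (nu : probability X R) (C : R) :
  (forall e : R, 0 < e -> exists n, \prod_(j < n) (#|Q j|.-1%:R / #|Q j|%:R) < e) ->
  (forall A, measurable A -> (nu A <= C%:E * unif01 A)%E) ->
  exists n, positive_in (limit_graphon Q_gt0 nu) (Q n).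
Proof.
move=> prod0 nuC; apply: contrapT => npos.
pose S n := [set v : level Q n | 0 < mass nu n v]%SET.
have null n (v : level Q n) : exists c : Q n, mass nu n.+1 (v, c) = 0.
  apply: contrapT => ncv; apply: npos; exists n; apply: (@positive_of_children _ _ _ _ _ v) => c.
  by rewrite lt_neqAle mass_ge0 andbT eq_sym; apply/eqP => c0; apply: ncv; exists c.
have cS n : (#|S n| <= \prod_(j < n) #|Q j|.-1)%N.
  elim: n => [|n IH]; first by rewrite big_ord0 (leq_trans (max_card _)) ?card_unit.
  have [c cP] := choice (@null n).
  rewrite big_ord_recr /=; apply: leq_trans (leq_mul IH (leqnn _)).
  have sub : S n.+1 \subset (\bigcup_(v in S n) [set (v, d) | d in [set~ c v]])%SET.
    apply/fintype.subsetP => -[v d]; rewrite inE => vd; apply/finset.bigcupP; exists v.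
      by rewrite inE (lt_le_trans vd) ?mass_parent.
    apply/imsetP; exists d; rewrite // !inE.
    by apply: contraTneq vd => ->; rewrite cP ltxx.
  apply: leq_trans (subset_leq_card sub) _.
  rewrite -sum_nat_const.
  elim/big_ind2: _ => [|A1 m1 A2 m2 le1 le2|v _]; first by rewrite cards0.
    exact: leq_trans (leq_card_setU _ _) (leq_add le1 le2).
  by rewrite (leq_trans (leq_imset_card _ _))// cardsC1.
have C_ge0 : 0 <= C.
  have := nuC setT measurableT.
  rewrite !probability_setT mule1 lee_fin; exact: le_trans.
have bound n : 1 <= C * \prod_(j < n) (#|Q j|.-1%:R / #|Q j|%:R).
  rewrite -[leLHS](@sum_mass R _ X nu _ (@address n)); last by move=> v; exact: measurable_address.
  rewrite (bigID (mem (S n))) /= [X in _ + X]big1 ?addr0 => [|v]; last first.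
    by rewrite inE -leNgt => v0; apply/eqP; rewrite eq_le v0 mass_ge0.
  apply: (@le_trans _ _ (\sum_(v in S n) C / #|level Q n|%:R)).
    apply: ler_sum => v _; rewrite -(mass_unif01 v) -lee_fin EFinM !massE;
      try by move=> w; exact: measurable_address.
    by apply: nuC; exact: measurable_address.
  rewrite sumr_const prod_card_level -[leLHS]mulr_natr.
  rewrite -[leLHS]mulrA ler_wpM2l// mulrC ler_wpM2r ?invr_ge0// ler_nat.
  exact: cS.
(* With the product below [1 / (C + 1)], [bound] would give [1 <= C / (C + 1)]; the summand 1 also
   covers [C = 0]. *)
have [n] := prod0 ((C + 1)^-1) (ltac:(by rewrite invr_gt0 ltr_wpDl)).
apply/negP; rewrite -leNgt.
have C1 : 0 < C + 1 by rewrite ltr_wpDl.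
rewrite -[leLHS]mul1r ler_pdivrMr//.
have := bound n; have : 0 <= \prod_(j < n) (#|Q j|.-1%:R / #|Q j|%:R : R).
  by apply: prodr_ge0 => j _; rewrite divr_ge0.
by move: (\prod_(j < n) _) => p; nra.
Qed.

Lemma ffact_le_expn n k : (n ^_ k <= n ^ k)%N.
Proof.
by elim: k => // k IH; rewrite ffactnSr expnSr leq_mul ?leq_subr.
Qed.

(** The ratio is the probability that [k] uniform draws from [N] are distinct. Each further draw
    costs a factor of at least [1 - k / N], and [(k + 1) ^ 2] exceeds [k ^ 2] by more than [k]. *)
Lemma ffact_expn_ratio (N k : nat) : (0 < N)%N ->
  1 - (k ^ 2)%:R / N%:R <= (N ^_ k)%:R / (N ^ k)%:R :> R.
Proof.
move=> N0; have N0' : (0 : R) < N%:R by rewrite ltr0n.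
have le1 j : (N ^_ j)%:R / (N ^ j)%:R <= 1 :> R.
  by rewrite ler_pdivrMr ?ltr0n ?expn_gt0 ?N0// mul1r ler_nat ffact_le_expn.
elim: k => [|k IH]; first by rewrite mul0r subr0 divr1.
have := le1 k; have : 0 <= (N ^_ k)%:R / (N ^ k)%:R :> R by rewrite divr_ge0.
have -> : (N ^_ k.+1)%:R / (N ^ k.+1)%:R =
    (N ^_ k)%:R / (N ^ k)%:R * ((N - k)%N%:R / N%:R) :> R.
  by rewrite ffactnSr expnSr !natrM invfM mulrACA.
move: (_ / (N ^ k)%:R) IH => r IH r0 r1.
have : 1 - k%:R / N%:R <= (N - k)%:R / N%:R :> R.
  rewrite ler_pdivlMr// mulrBl mul1r divfK ?gt_eqF// lerBlDr -natrD ler_nat.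
  by rewrite addnC -leq_subLR.
move: ((N - k)%:R / _) => s hs.
have k0 : 0 <= k%:R / N%:R :> R by rewrite divr_ge0.
have -> : (k.+1 ^ 2)%:R / N%:R = (k ^ 2)%:R / N%:R + 2 * (k%:R / N%:R) + N%:R^-1 :> R.
  by rewrite !expnS !expn0 !muln1 !natrM -natr1; ring.
have z0 : (0 : R) < N%:R^-1 by rewrite invr_gt0.
move: z0 k0 IH hs; move: (k%:R / N%:R) ((k ^ 2)%:R / N%:R) => y x.
move: (N%:R^-1) => z; nra.
Qed.

(** The level [n] addresses of the samples are uniform and independent. Distinct addresses decide
    the induced graph, and the error term is the probability of a repetition. *)
Lemma density_bounds (F : sgraph) n :
  let W := limit_graphon Q_gt0 (@unif01 R) in
  let N := #|level Q n| in
  let a := #|ind_embeddings F (level Q n)|%:R / (N ^ #|F|)%:R : R in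
  (a%:E <= ind_density F W)%E /\
  (ind_density F W <= (a + (1 - (N ^_ #|F|)%:R / (N ^ #|F|)%:R))%:E)%E.
Proof.
move=> W N a; set k := #|F|.
pose good (s : k.-tuple (level Q n)) := induces (edge (level Q n)) s && uniq s.
have meas (v : level Q n) : measurable (address n @^-1` [set v] : set X).
  exact: measurable_address.
have avg (P : pred (k.-tuple (level Q n))) :
    iterated_integral (@unif01 R) (fun t : k.-tuple X => (P (map_tuple (address n) t))%:R%:E) =
    (#|[set s | P s]%SET|%:R / (N ^ k)%:R)%:E.
  rewrite (@iterated_integral_step _ _ X _ _ _ meas k (fun s => (P s)%:R))//.
  congr EFin; rewrite (eq_bigr (fun s => (P s)%:R / (N ^ k)%:R)) => [|s _]; last first.
    rewrite (eq_bigr (fun=> N%:R^-1)) => [|i _]; last exact: mass_unif01.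
    by rewrite prodr_const card_ord natrX exprVn.
  rewrite -mulr_suml; congr (_ / _).
  rewrite -sum1_card natr_sum [RHS]big_mkcond /=.
  by apply: eq_bigr => s _; rewrite inE; case: (P s).
have dist : #|[set s : k.-tuple (level Q n) | ~~ uniq s]%SET|%:R / (N ^ k)%:R =
    1 - (N ^_ k)%:R / (N ^ k)%:R :> R.
  have Nk : (N ^ k)%:R != 0 :> R.
    by rewrite pnatr_eq0 -lt0n expn_gt0 card_level_gt0.
  rewrite -[X in X - _](divff Nk) -mulrBl; congr (_ / _).
  rewrite -natrB ?ffact_le_expn//; congr _%:R.
  pose U := [set s : k.-tuple (level Q n) | uniq s]%SET.
  have cU : #|U| = (N ^_ k)%N.
    rewrite -(card_uniq_tuples k (predT : pred (level Q n))).
    by apply: eq_card => s; rewrite !inE all_predT.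
  have := cardsC U; rewrite card_tuple cU -/N => <-; rewrite addKn.
  by apply: eq_card => s; rewrite !inE.
rewrite /a -card_ind_embeddings -dist -mulrDl -natrD.
split.
  rewrite -(avg good) ind_density_limit; apply: le_iterated_integral => t; rewrite lee_fin//.
  rewrite /good ler_nat; case: (boolP (uniq _)) => [/induces_address->|]; last by rewrite andbF.
  by rewrite andbT.
rewrite -cardsUI.
rewrite (_ : _ :&: _ = finset.set0)%SET ?cards0 ?addn0; last first.
  by apply/setP => s; rewrite !inE; case: (uniq s); rewrite ?andbF.
rewrite (_ : _ :|: _ = [set s | good s || ~~ uniq s])%SET; last first.
  by apply/setP => s; rewrite !inE.
rewrite -avg ind_density_limit; apply: le_iterated_integral => t; rewrite lee_fin//.
rewrite /good ler_nat; case: (boolP (uniq _)) => [/induces_address->|];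
  rewrite ?andbT ?orbT ?orbF//.
by rewrite leq_b1.
Qed.

Lemma card_level_gt n : (forall m, 1 < #|Q m|)%N -> (n < #|level Q n|)%N.
Proof.
move=> Q_gt1; elim: n => [|n IH]; first by rewrite card_unit.
rewrite card_levelS; apply: leq_ltn_trans IH _.
by rewrite -[ltnLHS]muln1 ltn_pmul2l ?Q_gt1// card_level_gt0.
Qed.

Lemma converges_to_limit : (forall n, 1 < #|Q n|)%N ->
  converges_to (level Q) (limit_graphon Q_gt0 (@unif01 R)).
Proof.
move=> Q_gt1; split.
  apply/cvgnyPge => A; near=> n; apply: leq_trans (ltnW (card_level_gt n Q_gt1)).
  by near: n; exact: nbhs_infty_ge.
move=> F; set W := limit_graphon _ _; set k := #|F|.
pose fd n : R := finite_ind_density R F (level Q n).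
have emb_le n : (#|ind_embeddings F (level Q n)| <= #|level Q n| ^_ k)%N.
  rewrite -card_ind_embeddings -(card_uniq_tuples k (predT : pred (level Q n))).
  by apply/subset_leq_card/fintype.subsetP => s; rewrite !inE all_predT => /andP[].
have bounds n := density_bounds F n.
have D_fin : ind_density F W \is a fin_num.
  have [l u] := bounds 0%N; rewrite fin_numE.
  by apply/andP; split; apply/eqP => DE; rewrite -/W DE in l u.
rewrite -(fineK D_fin); apply: cvg_EFin; first exact: nearW.
(* Although [fd n] is normalised by injective tuples and the bounds by all tuples, both densities
   lie in the interval of [density_bounds], whose width is at most [k ^ 2 / #|level Q n|]. *)
have close n : `|fine (ind_density F W) - fd n| <= (k ^ 2)%:R / n.+1%:R.
  have [] := bounds n; rewrite -/W -(fineK D_fin) !lee_fin.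
  move: (fine _) => r; rewrite -/k.
  have N0 : (0 < #|level Q n|)%N by exact: card_level_gt0.
  have := ffact_expn_ratio k N0.
  have : (k ^ 2)%:R / #|level Q n|%:R <= (k ^ 2)%:R / n.+1%:R :> R.
    by rewrite ler_wpM2l// lef_pV2 ?posrE ?ltr0n// ler_nat card_level_gt.
  move: ((k ^ 2)%:R / n.+1%:R) ((k ^ 2)%:R / _) => x y yx.
  have : fd n = #|ind_embeddings F (level Q n)|%:R / (#|level Q n| ^_ k)%:R by [].
  have c0 : (0 : R) < (#|level Q n| ^ k)%:R by rewrite ltr0n expn_gt0 N0.
  have : (#|ind_embeddings F (level Q n)|%:R : R) <= (#|level Q n| ^_ k)%:R.
    by rewrite ler_nat.
  have : ((#|level Q n| ^_ k)%:R : R) <= (#|level Q n| ^ k)%:R.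
    by rewrite ler_nat ffact_le_expn.
  have : (0 : R) <= #|ind_embeddings F (level Q n)|%:R by [].
  move: (#|ind_embeddings _ _|%:R) ((_ ^_ k)%:R) ((_ ^ k)%:R) c0 (fd n) => a b c c0 f a0 bc ab fE.
  have ci0 : 0 < c^-1 by rewrite invr_gt0.
  have cc : c * c^-1 = 1 by rewrite divff// gt_eqF.
  have fl : a / c <= f.
    (* For [F] larger than the level, [b] is 0 and the finite density is 0 by the convention for
       division. *)
    rewrite fE; have [b0|b0] := ltP 0 b; last first.
      have -> : a = 0 by lra.
      by rewrite !mul0r.
    by rewrite ler_wpM2l// lef_pV2.
  have fu : f <= a / c + (1 - b / c).
    rewrite fE; have [b0|b0] := ltP 0 b; last first.
      have -> : a = 0 by lra.
      have -> : b = 0 by lra.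
      by rewrite !mul0r add0r subr0.
    have bb : b * b^-1 = 1 by rewrite divff// gt_eqF.
    have -> : a / c + (1 - b / c) = a / b + (1 - a / b) * (1 - b / c).
      by rewrite mulrBl mul1r mulrBr mulr1 -mulrA [b^-1 * _]mulrA mulVf ?gt_eqF// mul1r; ring.
    by rewrite lerDl mulr_ge0// subr_ge0 ler_pdivrMr// mul1r.
  move: fl fu => + + + + +; move: (a / c) (b / c) => u w fl fu bc1 rl ru.
  rewrite /= ler_norml; apply/andP; split; lra.
apply/cvgrPdist_le => e e0; near=> n; apply: le_trans (close n) _.
rewrite ler_pdivrMr ?ltr0n// mulrC -ler_pdivrMr//.
apply: (@le_trans _ _ n%:R); last by rewrite ler_nat.
by near: n; exact: nbhs_infty_ger.
Unshelve. all: by end_near. Qed.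

End Limit.

(** * Subgraphon measures and the failure of weak randomness *)

Lemma wprob_le_scale (R : realType) (W : graphon R) (f : weight W) (A : set (gspace W)) :
  measurable A ->
  (wprob f A <= ((\int[gprob W]_x f x)^-1)%:E * gprob W A)%E.
Proof.
move=> mA; rewrite wprobE//; apply: lee_wpmul2l.
  by rewrite lee_fin invr_ge0 ltW// (wfun_pos f).
rewrite -[leRHS]mul1e -integral_cst//; apply: ge0_le_integral => //.
- by move=> x _; have /andP[] := wfun_range f x.
- by apply: measurable_funTS; apply/measurable_EFinP; exact: wfun_meas.
- by move=> x _; have /andP[] := wfun_range f x; rewrite lee_fin.
Qed.

Section IndicatorWeight.
Context (R : realType) (W : graphon R) (A : set (gspace W)).
Hypotheses (mA : measurable A) (A_gt0 : (0 < gprob W A)%E).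

Fact indic_range x : 0 <= (\1_A x : R) <= 1.
Proof. by rewrite indicE; case: (_ \in _); rewrite ?ler01 lexx. Qed.

Fact indic_pos : 0 < \int[gprob W]_x (\1_A x : R).
Proof.
rewrite /Rintegral integral_indic// setIT fine_gt0// A_gt0 /=.
by rewrite ltey_eq fin_num_measure.
Qed.

(** The corresponding subgraphon is [W] with its measure conditioned on [A]. *)
Definition indic_weight : weight W :=
  @Weight R W \1_A (measurable_indic mA) indic_range indic_pos.

Lemma wprob_indic_disjoint (B : set (gspace W)) :
  measurable B -> A `&` B = set0 -> wprob indic_weight B = 0%E.
Proof.
move=> mB AB; rewrite wprobE//= integral_indic// AB measure0 mule0//.
Qed.

End IndicatorWeight.

(** The invariant [p n ^+ 2 * (n + 4) <= 4] persists because [(1 - 1 / (2 m)) ^ 2 <= m / (m + 1)]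
    with [m = n + 4]; hence the product decays like an inverse square root. *)
Lemma prod_pred_ratio_small (R : realType) (q : nat -> nat) (e : R) :
  (forall n, q n = n.*2 + 8)%N -> 0 < e ->
  exists n, \prod_(j < n) ((q j).-1%:R / (q j)%:R) < e.
Proof.
move=> qE e0; pose p n : R := \prod_(j < n) ((q j).-1%:R / (q j)%:R).
have p0 n : 0 <= p n by apply: prodr_ge0 => j _; rewrite divr_ge0.
have p2 n : p n ^+ 2 * (n%:R + 4) <= 4.
  elim: n => [|n IH]; first by rewrite /p big_ord0 expr1n mul1r add0r.
  rewrite /p big_ord_recr /= -/(p n) qE exprMn.
  have -> : (n.*2 + 8).-1%:R = 2 * (n%:R + 4) - 1 :> R.
    by rewrite (_ : (n.*2 + 8).-1 = (2 * n + 7)%N) ?natrD ?natrM; [ring|lia].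
  have -> : (n.*2 + 8)%:R = 2 * (n%:R + 4) :> R by rewrite -mul2n natrD natrM; ring.
  rewrite -[n.+1%:R]natr1; have m0 : (0 : R) <= n%:R by [].
  move: (n%:R) m0 IH => x x0 IH.
  apply: le_trans IH; rewrite -mulrA ler_wpM2l ?sqr_ge0//.
  rewrite exprMn exprVn mulrAC ler_pdivrMr ?exprn_gt0//; last by lra.
  nra.
exists (Num.truncn (4 / e ^+ 2)); rewrite -/(p _).
have := truncn_itv (_ : 0 <= 4 / e ^+ 2); rewrite divr_ge0 ?sqr_ge0// => /(_ isT) /andP[_].
move: (Num.truncn _) => n; rewrite ltr_pdivrMr ?exprn_gt0// => ne.
rewrite ltNge; apply/negP => pe.
have := p2 n; rewrite leNgt => /negP; apply; apply: (lt_le_trans ne).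
rewrite mulrC; apply: ler_pM => //; rewrite ?sqr_ge0 //.
  by rewrite ler_pXn2r// ?nnegrE ?p0// ltW.
by rewrite -[n.+1%:R]natr1; lra.
Qed.

Lemma models_level (T : universal_theory) (Q : nat -> sgraph) :
  substitution_closed T -> (forall n, models T (Q n)) -> (forall n, (0 < #|Q n|)%N) ->
  forall n, models T (level Q n).
Proof.
move=> T_subst TQ Q_gt0; elim=> [|n IH]; last exact: models_lex.
have /card_gt0P[y _] := Q_gt0 0%N.
apply: (@models_embedding T _ _ (fun _ : point_graph => y) _ (TQ 0%N)).
by split=> [[] []//|x z]; rewrite edge_irr.
Qed.

Lemma weakly_random_EH_NIP (R : realType) (T : universal_theory) :
  weakly_random_EH R T -> substitution_closed T -> NIP T.
Proof.
move=> T_EH T_subst; apply: contrapT => /not_NIP_prime_antichain.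
move=> [P [TP P_prime P_anti cP]].
have P_gt2 n : (2 < #|P n|)%N by rewrite cP; lia.
have P_gt0 n : (0 < #|P n|)%N by rewrite cP; lia.
pose W := limit_graphon P_gt0 (@unif01 R).
have [|f f_random] := T_EH W.
  exists (level P); first exact: models_level.
  by apply: converges_to_limit => n; exact: ltnW.
pose nu : probability (measurableTypeR R) R := gprob (subgraphon f).
have [||n n_pos] := @some_positive P P_gt0 R nu (\int[@unif01 R]_x f x)^-1.
- by move=> e; exact: (@prod_pred_ratio_small R (fun n => #|P n|) e cP).
- by move=> A mA; exact: wprob_le_scale.
have meas m (v : level P m) :
    measurable (@address P P_gt0 R m @^-1` [set v] : set (measurableTypeR R)).
  exact: measurable_address.
have [v v_gt0] : exists v, 0 < mass nu (@address P P_gt0 R n.+1) v.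
  apply: contrapT => nv; have := sum_mass nu (meas n.+1); rewrite big1 => [/eqP|v _].
    by rewrite eq_sym oner_eq0.
  apply/eqP; rewrite eq_le mass_ge0 andbT leNgt; apply/negP => v0.
  by apply: nv; exists v.
have C_gt0 : (0 < nu (@address P P_gt0 R n.+1 @^-1` [set v]))%E.
  by rewrite -massE.
(* Weak randomness carries the positive density of [P n] over to [nu] conditioned on the cylinder of
   [v], where all other cylinders of level [n + 1] are null. *)
pose g := @indic_weight R (subgraphon f) _ (meas _ v) C_gt0.
have /(f_random g (P n)) : positive_in (subgraphon f) (P n) by exact: n_pos.
pose nu' : probability (measurableTypeR R) R := gprob (subgraphon g).
apply: (@not_positive_in_cylinder P P_gt0 R P_prime P_anti P_gt2 nu' n v) => w wv.
rewrite /mass (_ : nu' _ = 0%E)//; apply: wprob_indic_disjoint => //.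
by apply/seteqP; split=> x //= [xv xw]; rewrite -xw xv eqxx in wv.
Qed.

Theorem theorem6p10 :
  (forall T : universal_theory, primally_almost_finite T -> NIP T) /\
  (forall (R : realType) (T' : universal_theory),
     weakly_random_EH R T' -> substitution_closed T' -> NIP T').
Proof.
by split; [exact: primally_almost_finite_NIP|exact: weakly_random_EH_NIP].
Qed.
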